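(* Let $\phi(r)$ be a positive non-decreasing function defined on $[1,\infty)$ with $\lim_{r\to\infty}\phi(r) = \infty$. Then there exists a function $f$ transcendental and meromorphic in the plane with $$\limsup_{r\to\infty} \frac{T(r,f)}{r} < \infty \quad\text{and}\quad \liminf_{r\to\infty}\frac{T(r,f)}{\phi(r)\log r} < \infty,$$ such that $g(z) = \Delta f(z) = f(z+1) - f(z)$ has exactly one zero. Moreover, $g$ satisfies $$\limsup_{r\to\infty}\frac{T(r,g)}{\phi(r)\log r} < \infty.$$
   Context: $T(r,f)$ denotes the Nevanlinna characteristic of a meromorphic function $f$. *)

(* Defs.v *)
From HB Require Import structures.
From mathcomp Require Import all_boot all_order all_algebra.
From mathcomp Require Import all_classical all_reals all_analysis.
From mathcomp Require Import complex.
Set Implicit Arguments. Unset Strict Implicit. Unset Printing Implicit Defensive.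
Import Order.TTheory GRing.Theory Num.Theory.
Local Open Scope classical_set_scope.
Local Open Scope ring_scope.

Section Nevanlinna.
Variable R : realType.
Local Notation C := (R[i]).

Definition cmod (z : C) : R :=
  Num.sqrt (complex.Re z ^+ 2 + complex.Im z ^+ 2).

Definition holo_at (f : C -> C) (z : C) : Prop :=
  exists l : C, forall eps : R, 0 < eps -> exists del : R, 0 < del /\
    forall h : C, 0 < cmod h < del -> cmod ((f (z + h) - f z) / h - l) < eps.

Definition locally_zero (f : C -> C) (a : C) : Prop :=
  exists r : R, 0 < r /\ forall z, 0 < cmod (z - a) < r -> f z = 0.

(* f has order m (m > 0: zero of multiplicity m; m < 0: pole of
   multiplicity -m; m = 0: regular nonzero value) at a, i.e.
   f z = (z - a)^m h z near a (z <> a), h holomorphic near a, h a <> 0.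
   The value f a itself is irrelevant. *)
Definition has_order (f : C -> C) (a : C) (m : int) : Prop :=
  exists r : R, 0 < r /\ exists h : C -> C,
    (forall z, cmod (z - a) < r -> holo_at h z) /\ h a != 0 /\
    forall z, 0 < cmod (z - a) < r -> f z = (z - a) ^ m * h z.

Definition meromorphic (f : C -> C) : Prop :=
  forall a : C, locally_zero f a \/ exists m : int, has_order f a m.

Definition order (f : C -> C) (a : C) : int := xget 0 (has_order f a).

Definition pole_mult (f : C -> C) (a : C) : R := (Num.max 0 (- order f a))%:~R.

Definition is_zero (f : C -> C) (a : C) : Prop :=
  locally_zero f a \/ (0 < order f a)%R.

(* rational function: f = P/Q as meromorphic functions *)
Definition rational (f : C -> C) : Prop :=
  exists P Q : {poly C}, Q != 0 /\ forall a : C, exists r : R, 0 < r /\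
    forall z, 0 < cmod (z - a) < r -> Q.[z] != 0 -> f z = P.[z] / Q.[z].

Definition transcendental_meromorphic (f : C -> C) : Prop :=
  meromorphic f /\ ~ rational f.

Definition npoles (f : C -> C) (t : R) : R :=
  \sum_(a \in [set z : C | cmod z <= t]) pole_mult f a.

Definition circ (r t : R) : C := Complex (r * cos t) (r * sin t).

Definition logplus (x : R) : R := Num.max 0 (ln x).

Definition proximity (f : C -> C) (r : R) : \bar R :=
  ((2 * pi)^-1)%:E *
  (\int[lebesgue_measure]_(t in `[0%R, (2 * pi)%R]) (logplus (cmod (f (circ r t))))%:E)%E.

Definition counting (f : C -> C) (r : R) : \bar R :=
  ((\int[lebesgue_measure]_(t in `]0%R, r]) ((npoles f t - npoles f 0) / t)%:E)
   + (npoles f 0 * ln r)%:E)%E.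

Definition nevT (f : C -> C) (r : R) : \bar R := (proximity f r + counting f r)%E.

End Nevanlinna.

(* Main.v *)
(* Idea. Let n_0 < n_1 < ... be very sparse integers and put
     g(z) = z / prod_k (1 + z^4 / (4 n_k^4)).
   Its only zero is 0 and its poles are the corners n_k (+-1 +- i) of squares.
   The residues are real multiples of z / (z^4)', that is, of z^-2; so those
   at the two ends n_k (-1 + i), n_k (1 + i) of the upper side are opposite
   (likewise for the lower side), and the ends differ by the integer 2 n_k.
   Hence each such pair of terms telescopes as the difference of a string of
   2 n_k simple poles with equal residues, and the sum f of all the strings
   satisfies f(z+1) - f(z) = g(z).
   The number of poles of f in |z| <= t is at most 8 t, and it stays at most
   8 n_k until t reaches n_(k+1); taking n_(k+1) far beyond a radius where phi
   exceeds 8 n_k gives the liminf.  For g there are only 4 poles per k.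
   The residues are so small that even their square roots are summable, which
   makes the proximity functions bounded: log+ x <= 2 sqrt x, sqrt is
   subadditive, and the mean of |r e^it - p|^(-1/2) is bounded uniformly in p
   and r >= 1.
   Sums of c / (z - p) are handled without power series: expanding 1 / (z - p)
   around a regular point a with remainder shows that the sum is locally zero
   or has a finite order at a. *)

Require Import Defs.
From HB Require Import structures.
From mathcomp Require Import all_boot all_order all_algebra.
From mathcomp Require Import all_classical all_reals all_analysis.
From mathcomp Require Import measurable_realfun complex.
From mathcomp Require Import ring lra zify.
Import Order.TTheory GRing.Theory Num.Theory.
Import numFieldNormedType.Exports.
Local Open Scope classical_set_scope.
Local Open Scope ring_scope.

(** * Modulus and series in [R[i]] *)

Section ComplexModulus.
Set Implicit Arguments. Unset Strict Implicit.
Variable R : realType.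
Local Notation C := (R[i]).
Implicit Types (z w l : C) (u v : nat -> C).

Lemma cmodE z : cmod z = Normc.normc z.
Proof. by case: z. Qed.

Lemma cmod_ge0 z : 0 <= cmod z.
Proof. exact: sqrtr_ge0. Qed.

Lemma cmod0 : cmod (0 : C) = 0.
Proof. by rewrite cmodE Normc.normc0. Qed.

Lemma cmod1 : cmod (1 : C) = 1.
Proof. by rewrite cmodE Normc.normc1. Qed.

Lemma cmod_eq0 z : (cmod z == 0) = (z == 0).
Proof.
apply/eqP/eqP => [|->]; last exact: cmod0.
by rewrite cmodE; exact: Normc.eq0_normc.
Qed.

Lemma cmod_gt0 z : (0 < cmod z) = (z != 0).
Proof. by rewrite lt_def cmod_ge0 andbT cmod_eq0. Qed.

Lemma cmodM z w : cmod (z * w) = cmod z * cmod w.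
Proof. by rewrite !cmodE Normc.normcM. Qed.

Lemma cmodV z : cmod z^-1 = (cmod z)^-1.
Proof. by rewrite !cmodE Normc.normcV. Qed.

Lemma cmodX z n : cmod (z ^+ n) = cmod z ^+ n.
Proof. by elim: n => [|n ih]; rewrite ?cmod1 // !exprS cmodM ih. Qed.

Lemma cmodN z : cmod (- z) = cmod z.
Proof. by rewrite !cmodE normcN. Qed.

Lemma cmod_distC z w : cmod (z - w) = cmod (w - z).
Proof. by rewrite -cmodN opprB. Qed.

Lemma cmodD z w : cmod (z + w) <= cmod z + cmod w.
Proof. by rewrite !cmodE le_normcD. Qed.

Lemma cmodB z w : cmod z - cmod w <= cmod (z - w).
Proof. by rewrite lerBlDr; apply: le_trans (cmodD _ _); rewrite subrK. Qed.

Lemma cmod_sum (I : Type) (s : seq I) (P : pred I) (F : I -> C) :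
  cmod (\sum_(i <- s | P i) F i) <= \sum_(i <- s | P i) cmod (F i).
Proof.
elim/big_ind2: _ => [|x1 x2 y1 y2 h1 h2|//]; first by rewrite cmod0.
by apply: le_trans (cmodD _ _) _; apply: lerD.
Qed.

Lemma cmod_real (x : R) : cmod (x%:C%C) = `|x|.
Proof. by rewrite /cmod /= expr0n addr0 sqrtr_sqr. Qed.

Lemma Re_le_cmod z : `|complex.Re z| <= cmod z.
Proof. by rewrite -sqrtr_sqr ler_wsqrtr // lerDl sqr_ge0. Qed.

Lemma Im_le_cmod z : `|complex.Im z| <= cmod z.
Proof. by rewrite -sqrtr_sqr ler_wsqrtr // lerDr sqr_ge0. Qed.

Lemma cmod_le_ReIm z : cmod z <= `|complex.Re z| + `|complex.Im z|.
Proof.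
rewrite /cmod -[leRHS]ger0_norm ?addr_ge0// -sqrtr_sqr ler_wsqrtr //.
rewrite sqrrD !real_normK ?num_real// -addrA lerD2l lerDr.
by rewrite mulrn_wge0 // mulr_ge0.
Qed.

(** Convergence is measured by the real-valued modulus, in the same epsilon form as [holo_at], so
    limits and derivatives combine directly. *)
Definition cvgC u l :=
  forall eps : R, 0 < eps -> exists N, forall n, (N <= n)%N -> cmod (u n - l) < eps.

Lemma cvgC_unique u l1 l2 : cvgC u l1 -> cvgC u l2 -> l1 = l2.
Proof.
move=> h1 h2; apply/eqP; rewrite -subr_eq0 -cmod_eq0; apply/negPn/negP => ne.
have e0 : 0 < cmod (l1 - l2) / 2 by rewrite divr_gt0 // lt_def ne cmod_ge0.
have [N1 H1] := h1 _ e0; have [N2 H2] := h2 _ e0.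
have := H1 (maxn N1 N2) (leq_maxl _ _); have := H2 (maxn N1 N2) (leq_maxr _ _).
set x := u _ => a b.
have : cmod (l1 - l2) <= cmod (x - l1) + cmod (x - l2).
  by rewrite (cmod_distC x l1); apply: le_trans (cmodD _ _); rewrite addrA subrK.
by move: a b; lra.
Qed.

Lemma cvgC_ext u v l : u =1 v -> cvgC u l -> cvgC v l.
Proof.
by move=> e h eps /h[N H]; exists N => n /H; rewrite e.
Qed.

Lemma cvgC_cst l : cvgC (fun=> l) l.
Proof. by move=> e e0; exists 0%N => n _; rewrite subrr cmod0. Qed.

Lemma cvgCD u v l m : cvgC u l -> cvgC v m -> cvgC (fun n => u n + v n) (l + m).
Proof.
move=> hu hv e e0; have e2 : 0 < e / 2 by rewrite divr_gt0.
have [N1 H1] := hu _ e2; have [N2 H2] := hv _ e2.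
exists (maxn N1 N2) => n; rewrite geq_max => /andP[/H1 a /H2 b].
by rewrite opprD addrACA; apply: le_lt_trans (cmodD _ _) _; lra.
Qed.

Lemma cvgCZ u l c : cvgC u l -> cvgC (fun n => c * u n) (c * l).
Proof.
move=> hu e e0; have c1 : 0 < cmod c + 1 by rewrite ltr_wpDl ?cmod_ge0.
have [N1 H1] := hu _ (divr_gt0 e0 c1); exists N1 => n /H1 a.
rewrite -mulrBr cmodM; apply: (@le_lt_trans _ _ ((cmod c + 1) * cmod (u n - l))).
  by rewrite ler_wpM2r ?cmod_ge0 // lerDl.
by rewrite mulrC -ltr_pdivlMr.
Qed.

Lemma cvgCB u v l m : cvgC u l -> cvgC v m -> cvgC (fun n => u n - v n) (l - m).
Proof.
move=> hu /(@cvgCZ _ _ (-1)) hv; rewrite -[- m]mulN1r.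
by apply: cvgC_ext (cvgCD hu hv) => n; rewrite mulN1r.
Qed.

Lemma cvgC_le u l (B : R) : cvgC u l -> (forall n, cmod (u n) <= B) -> cmod l <= B.
Proof.
move=> h hB; rewrite leNgt; apply/negP => lt.
have [N H] := h (cmod l - B) ltac:(by rewrite subr_gt0).
have a := H N (leqnn _); have b := hB N; rewrite cmod_distC in a.
by have := cmodB l (u N); lra.
Qed.

Lemma cvgC_ge u l (B : R) : cvgC u l -> (forall n, B <= cmod (u n)) -> B <= cmod l.
Proof.
move=> h hB; rewrite leNgt; apply/negP => lt.
have [N H] := h (B - cmod l) ltac:(by rewrite subr_gt0).
have a := H N (leqnn _); have b := hB N.
by have := cmodB (u N) l; lra.
Qed.

Lemma cvgC_eventually u v l : cvgC u l ->
  (exists N, forall n, (N <= n)%N -> v n = u n) -> cvgC v l.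
Proof.
move=> h [M hM] e /h[N H]; exists (maxn M N) => n.
by rewrite geq_max => /andP[a b]; rewrite hM // H.
Qed.

(** * Absolutely convergent complex series *)

Definition psum u (n : nat) : C := \sum_(k < n) u k.

Lemma bounded_sum_cvg (a : nat -> R) (B : R) : (forall k, 0 <= a k) ->
  (forall n, \sum_(k < n) a k <= B) -> cvgn (series a).
Proof.
move=> a0 aB; apply: nondecreasing_is_cvgn.
  by apply: nondecreasing_series => n _ _; exact: a0.
exists B => _ [n _ <-]; rewrite /series /= big_mkord; exact: aB.
Qed.

Lemma dominated_sum_cvg (a b : nat -> R) (B : R) : (forall k, `|a k| <= b k) ->
  (forall n, \sum_(k < n) b k <= B) ->
  exists l : R, forall eps : R, 0 < eps -> exists N, forall n, (N <= n)%N ->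
    `|\sum_(k < n) a k - l| < eps.
Proof.
move=> ab bB.
have cb : cvgn (series b).
  apply: (@bounded_sum_cvg b B) bB => k; have := ab k; have := normr_ge0 (a k); lra.
have : cvgn [normed series a].
  apply: series_le_cvg cb => [n|n|n]; [exact: normr_ge0| have := ab n; have := normr_ge0 (a n); lra|exact: ab].
move/normed_cvg => /cvgrPdist_lt h; exists (limn (series a)) => e /h[N _ H].
exists N => n /H; rewrite /= distrC; apply: le_lt_trans.
by rewrite /series /= big_mkord.
Qed.

Lemma psum_cvg u (B : R) : (forall n, \sum_(k < n) cmod (u k) <= B) ->
  exists l, cvgC (psum u) l.
Proof.
move=> hB.
have [x hx] := @dominated_sum_cvg (fun k => complex.Re (u k)) _ _ (fun k => Re_le_cmod (u k)) hB.
have [y hy] := @dominated_sum_cvg (fun k => complex.Im (u k)) _ _ (fun k => Im_le_cmod (u k)) hB.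
exists (Complex x y) => e e0; have e2 : 0 < e / 2 by rewrite divr_gt0.
have [N1 H1] := hx _ e2; have [N2 H2] := hy _ e2.
exists (maxn N1 N2) => n; rewrite geq_max => /andP[/H1 a /H2 b].
apply: le_lt_trans (cmod_le_ReIm _) _; rewrite !raddfB /= /psum.
by rewrite !raddf_sum; move: a b; lra.
Qed.

Definition csum u : C := xget 0 (cvgC (psum u)).

Lemma csum_def u l : cvgC (psum u) l -> csum u = l.
Proof.
move=> h; apply: (cvgC_unique (u := psum u)) => //.
exact: (xgetPex 0 (ex_intro (cvgC (psum u)) l h)).
Qed.

Lemma csumP u (B : R) : (forall n, \sum_(k < n) cmod (u k) <= B) ->
  cvgC (psum u) (csum u).
Proof. by move=> /psum_cvg[l h]; rewrite (csum_def h). Qed.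

Lemma csum_le u (B : R) : (forall n, \sum_(k < n) cmod (u k) <= B) ->
  cmod (csum u) <= B.
Proof.
move=> h; apply: cvgC_le (csumP h) _ => n.
by apply: le_trans (cmod_sum _ _ _) _; exact: h.
Qed.

End ComplexModulus.

(** * Order of a function at a point *)

Section LocalOrder.
Set Implicit Arguments. Unset Strict Implicit.
Variable R : realType.
Local Notation C := (R[i]).
Implicit Types (f h : C -> C) (a z : C) (m : int).

Lemma exists_near a (r : R) : 0 < r -> exists z, 0 < cmod (z - a) < r.
Proof.
move=> r0; exists (a + (r / 2)%:C%C); rewrite addrC addKr cmod_real.
by rewrite gtr0_norm; lra.
Qed.

Lemma holo_at_continuous f z : holo_at f z -> forall eps : R, 0 < eps ->
  exists del : R, 0 < del /\ forall w, cmod (w - z) < del -> cmod (f w - f z) < eps.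
Proof.
move=> [l hl] e e0; have [d [d0 H]] := hl 1 ltr01.
have c0 : 0 < cmod l + 1 by rewrite ltr_wpDl ?cmod_ge0.
exists (Num.min d (e / (cmod l + 1))); split.
  by rewrite lt_min d0 divr_gt0.
move=> w; rewrite lt_min => /andP[wd we].
have [->|wz] := eqVneq w z; first by rewrite subrr cmod0.
have wz0 : w - z != 0 by rewrite subr_eq0.
have := H (w - z); rewrite cmod_gt0 wz0 wd => /(_ isT).
rewrite [z + _]addrC subrK => Hw.
have q : cmod ((f w - f z) / (w - z)) <= cmod l + 1.
  by rewrite -(subrK l (_ / _)); apply: le_trans (cmodD _ _) _; lra.
rewrite -(divfK wz0 (f w - f z)) cmodM.
apply: le_lt_trans (_ : (cmod l + 1) * cmod (w - z) < e).
  by rewrite ler_wpM2r ?cmod_ge0.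
by rewrite mulrC -ltr_pdivlMr.
Qed.

(** Serves twice: for the numerator [g + (z - a) * h z] at a simple pole, and as the Horner step for
    polynomials. *)
Lemma holo_at_affineM (g a : C) f z : holo_at f z ->
  holo_at (fun w => g + (w - a) * f w) z.
Proof.
move=> hf; have hc := holo_at_continuous hf; case: hf => l hl.
exists (f z + (z - a) * l) => e e0.
have c0 : 0 < cmod (z - a) + 1 by rewrite ltr_wpDl ?cmod_ge0.
have [d1 [d10 H1]] := hc (e / 2) ltac:(by rewrite divr_gt0).
have [d2 [d20 H2]] := hl (e / 2 / (cmod (z - a) + 1)) ltac:(by rewrite !divr_gt0).
exists (Num.min d1 d2); split; first by rewrite lt_min d10.
move=> k; rewrite lt_min => /and3P[k0 kd1 kd2].
have := H1 (z + k); rewrite addrC addKr => /(_ kd1) b1.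
have := H2 k; rewrite k0 kd2 => /(_ isT) b2.
have kn : k != 0 by rewrite -cmod_gt0.
have -> : (g + (z + k - a) * f (z + k) - (g + (z - a) * f z)) / k
     - (f z + (z - a) * l) =
   (f (z + k) - f z) + (z - a) * ((f (z + k) - f z) / k - l) by field.
apply: le_lt_trans (cmodD _ _) _; rewrite cmodM.
have : cmod (z - a) * cmod ((f (z + k) - f z) / k - l) < e / 2.
  apply: le_lt_trans (_ : (cmod (z - a) + 1) * cmod ((f (z + k) - f z) / k - l) < _).
    by rewrite ler_wpM2r ?cmod_ge0 // lerDl.
  by rewrite mulrC -ltr_pdivlMr.
by move: b1; lra.
Qed.

Lemma holo_at_nonzero h a : holo_at h a -> h a != 0 ->
  exists del : R, 0 < del /\ forall w, cmod (w - a) < del -> cmod (h a) / 2 < cmod (h w).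
Proof.
move=> /holo_at_continuous hc ha.
have [d [d0 H]] := hc (cmod (h a) / 2) ltac:(by rewrite divr_gt0 // cmod_gt0).
exists d; split=> // w /H; rewrite cmod_distC => b.
by have := cmodB (h a) (h w); lra.
Qed.

Lemma has_order_nonzero f a m : has_order f a m ->
  exists r : R, 0 < r /\ forall z, 0 < cmod (z - a) < r -> f z != 0.
Proof.
move=> [r [r0 [h [hh [ha fE]]]]].
have [d [d0 H]] := holo_at_nonzero (hh a ltac:(by rewrite subrr cmod0)) ha.
exists (Num.min r d); split; first by rewrite lt_min r0.
move=> z; rewrite lt_min => /and3P[z0 zr zd]; rewrite fE ?z0//.
rewrite mulf_neq0 ?expfz_neq0// -cmod_gt0 //.
by apply: lt_trans (H _ zd); rewrite divr_gt0 // cmod_gt0.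
Qed.

Lemma locally_zero_order f a : locally_zero f a -> Defs.order f a = 0.
Proof.
move=> [r [r0 fz]]; apply: xgetPN => m /has_order_nonzero[s [s0 fn]].
have [|z] := @exists_near a (Num.min r s); first by rewrite lt_min r0.
rewrite lt_min => /and3P[z0 zr zs].
by have := fn z; rewrite z0 zs fz ?z0// eqxx => /(_ isT).
Qed.

(** If m' = m + k + 1, cancelling [(z - a) ^ m] leaves h z = (z - a)^(k+1) h' z near a. The right
    side tends to 0, while the left side stays above |h a| / 2. *)
Lemma has_order_le f a m m' : has_order f a m -> has_order f a m' -> m' <= m.
Proof.
move=> [r [r0 [h [hh [ha fE]]]]] [r' [r0' [h' [hh' [ha' fE']]]]].
rewrite leNgt; apply/negP => lt.
have [k mE] : exists k : nat, m' = m + k.+1%:Z.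
  exists (absz (m' - m)).-1; lia.
have [d [d0 H]] := holo_at_nonzero (hh a ltac:(by rewrite subrr cmod0)) ha.
have [d' [d0' H']] := holo_at_continuous (hh' a ltac:(by rewrite subrr cmod0)) ltr01.
have c0 : 0 < cmod (h' a) + 1 by rewrite ltr_wpDl ?cmod_ge0.
have q0 : 0 < cmod (h a) / 2 by rewrite divr_gt0 // cmod_gt0.
(* The last entry forces |z - a| (|h' a| + 1) < |h a| / 2; the entry 1 allows (z - a)^(k+1) to be
   bounded by its first power. *)
pose s := Num.min (Num.min r r') (Num.min (Num.min d d')
   (Num.min 1 (cmod (h a) / 2 / (cmod (h' a) + 1)))).
have [|z] := @exists_near a s; first by rewrite !lt_min r0 r0' d0 d0' ltr01 divr_gt0.
rewrite !lt_min => /andP[z0 /andP[/andP[zr zr'] /andP[/andP[zd zd'] /andP[z1 zq]]]].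
have zn : z - a != 0 by rewrite -cmod_gt0.
have := fE z; rewrite z0 zr => /(_ isT) e1.
have := fE' z; rewrite z0 zr' => /(_ isT); rewrite e1 mE expfzDr // -mulrA.
move/(mulfI (expfz_neq0 m zn)) => hE.
have := H _ zd; rewrite hE cmodM cmodX => b.
have b' : cmod (h' z) <= cmod (h' a) + 1.
  by have := H' _ zd'; have := cmodB (h' z) (h' a); lra.
have : cmod (z - a) ^+ k.+1 * cmod (h' z) <= cmod (z - a) * (cmod (h' a) + 1).
  apply: ler_pM => //; rewrite ?exprn_ge0 ?cmod_ge0 //.
  by rewrite exprS ler_piMr ?cmod_ge0 // exprn_ile1 ?cmod_ge0 // ltW.
have : cmod (z - a) * (cmod (h' a) + 1) < cmod (h a) / 2.
  by rewrite -ltr_pdivlMr.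
lra.
Qed.

Lemma has_order_eq f a m : has_order f a m -> Defs.order f a = m.
Proof.
move=> hm; apply: xget_unique => // m' hm'.
by apply/eqP; rewrite eq_le (has_order_le hm hm') (has_order_le hm' hm).
Qed.

Lemma has_order_locally_zero f a m : has_order f a m -> ~ locally_zero f a.
Proof.
move=> /has_order_nonzero[s [s0 fn]] [r [r0 fz]].
have [|z] := @exists_near a (Num.min r s); first by rewrite lt_min r0.
rewrite lt_min => /and3P[z0 zr zs].
by have := fn z; rewrite z0 zs fz ?z0// eqxx => /(_ isT).
Qed.

Lemma is_zero_order f a m : has_order f a m -> is_zero f a <-> 0 < m.
Proof.
move=> hm; rewrite /is_zero (has_order_eq hm); split=> [[]//|]; last by right.
by move/(has_order_locally_zero hm).
Qed.

End LocalOrder.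

(** * Sums of simple fractions *)

Section CauchySums.
Set Implicit Arguments. Unset Strict Implicit.
Variable R : realType.
Local Notation C := (R[i]).
Implicit Types (w : nat -> seq (C * C)) (a z : C).

(** An entry of [w k] is a pair (residue, pole). Poles come in finite blocks, and the series runs
    over the blocks. *)
Definition cterm w z (k : nat) : C := \sum_(q <- w k) q.1 / (z - q.2).

Definition cauchy w z : C := csum (cterm w z).

Definition mass w (k : nat) : R := \sum_(q <- w k) cmod q.1.

Definition mass_le w (B : R) := forall n, \sum_(k < n) mass w k <= B.

Definition avoids w z (d : R) :=
  forall k q, q \in w k -> d <= cmod (z - q.2).

(** Residues of the remainder after m steps of 1 / (z - p) = 1 / (a - p) + (z - a) / ((p - a) (z -
    p)). Its sum at [a] is the m-th Taylor coefficient at [a]. *)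
Definition shift a (m : nat) w k : seq (C * C) :=
  [seq (q.1 / (q.2 - a) ^+ m, q.2) | q <- w k].

Lemma mass_le_ge0 w (B : R) : mass_le w B -> 0 <= B.
Proof. by move=> /(_ 0%N); rewrite big_ord0. Qed.

Lemma block_le w (t : C * C -> C) (M : R) k :
  (forall q, q \in w k -> cmod (t q) <= M * cmod q.1) ->
  cmod (\sum_(q <- w k) t q) <= M * mass w k.
Proof.
move=> h; apply: le_trans (cmod_sum _ _ _) _; rewrite mulr_sumr.
by rewrite big_seq [leRHS]big_seq; apply: ler_sum => q /h.
Qed.

Lemma blocks_le w (t : C * C -> C) (M B : R) : mass_le w B -> 0 <= M ->
  (forall k q, q \in w k -> cmod (t q) <= M * cmod q.1) ->
  forall n, \sum_(k < n) cmod (\sum_(q <- w k) t q) <= M * B.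
Proof.
move=> hB M0 h n; apply: le_trans (_ : \sum_(k < n) M * mass w k <= _).
  by apply: ler_sum => k _; apply: block_le; exact: h.
by rewrite -mulr_sumr ler_wpM2l.
Qed.

Lemma cterm_bound w z (d : R) q k : 0 < d -> avoids w z d -> q \in w k ->
  cmod (q.1 / (z - q.2)) <= d^-1 * cmod q.1.
Proof.
move=> d0 h /h dz; rewrite cmodM cmodV mulrC ler_wpM2r ?cmod_ge0//.
by rewrite lef_pV2 // posrE; exact: lt_le_trans dz.
Qed.

Lemma cauchy_cvg w z (B d : R) : mass_le w B -> 0 < d -> avoids w z d ->
  cvgC (psum (cterm w z)) (cauchy w z).
Proof.
move=> hB d0 hd; apply: (@csumP _ _ (d^-1 * B)) => n.
by apply: blocks_le => // [|k q]; [rewrite invr_ge0 ltW|exact: cterm_bound].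
Qed.

Lemma cauchy_le w z (B d : R) : mass_le w B -> 0 < d -> avoids w z d ->
  cmod (cauchy w z) <= d^-1 * B.
Proof.
move=> hB d0 hd; apply: csum_le => n.
by apply: blocks_le => // [|k q]; [rewrite invr_ge0 ltW|exact: cterm_bound].
Qed.

Lemma avoids_near w a z (d : R) : avoids w a d -> cmod (z - a) < d / 2 ->
  avoids w z (d / 2).
Proof.
move=> h za k q /h b; have := cmodB (a - q.2) (a - z).
rewrite (cmod_distC a z) (_ : _ - (a - z) = z - q.2); [lra|by ring].
Qed.

Lemma avoids_neq w z (d : R) q k : 0 < d -> avoids w z d -> q \in w k ->
  z - q.2 != 0.
Proof. by move=> d0 h /h dz; rewrite -cmod_gt0; exact: lt_le_trans dz. Qed.

Lemma psum_blocks w (t s : C * C -> C) n :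
  psum (fun k => \sum_(q <- w k) t q) n + psum (fun k => \sum_(q <- w k) s q) n =
  psum (fun k => \sum_(q <- w k) (t q + s q)) n.
Proof. by rewrite /psum -big_split; apply: eq_bigr => k _; rewrite big_split. Qed.

Lemma psum_blocksZ w (t : C * C -> C) c n :
  c * psum (fun k => \sum_(q <- w k) t q) n =
  psum (fun k => \sum_(q <- w k) c * t q) n.
Proof. by rewrite /psum mulr_sumr; apply: eq_bigr => k _; rewrite mulr_sumr. Qed.

Lemma eq_psum_blocks w (t s : C * C -> C) n :
  (forall k q, q \in w k -> t q = s q) ->
  psum (fun k => \sum_(q <- w k) t q) n = psum (fun k => \sum_(q <- w k) s q) n.
Proof.
move=> h; rewrite /psum; apply: eq_bigr => k _.
by rewrite big_seq [RHS]big_seq; apply: eq_bigr => q; exact: h.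
Qed.

(** The derivative is the termwise one, with terms -c / (z - p)^2. The error of the difference
    quotient has terms h c / ((z - p)^2 (z + h - p)), so it is O(h). *)
Lemma holo_cauchy w z (B d : R) : mass_le w B -> 0 < d -> avoids w z d ->
  holo_at (cauchy w) z.
Proof.
move=> hB d0 hd; have B0 := mass_le_ge0 hB.
pose t (q : C * C) := - (q.1 / (z - q.2) ^+ 2).
have tb k q : q \in w k -> cmod (t q) <= d^-1 ^+ 2 * cmod q.1.
  move=> qw; rewrite cmodN cmodM cmodV cmodX mulrC ler_wpM2r ?cmod_ge0//.
  rewrite -exprVn lerXn2r ?nnegrE ?invr_ge0 ?cmod_ge0 ?(ltW d0)//.
  rewrite lef_pV2 ?posrE ?(lt_le_trans d0)//; exact: hd qw.
have dV0 : 0 <= d^-1 ^+ 2 by rewrite exprn_ge0 // invr_ge0 ltW.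
pose u k := \sum_(q <- w k) t q.
have tl : cvgC (psum u) (csum u) := csumP (blocks_le hB dV0 tb).
pose l := csum u; exists l => e e0.
(* The distances d, d and d / 2 in the error term give 2 / d^3; the added 1 makes [K] positive. *)
pose K := 2 * d^-1 ^+ 3 * B + 1.
have dV3 : 0 <= d^-1 ^+ 3 by rewrite exprn_ge0 // invr_ge0 ltW.
have K0 : 0 < K by rewrite ltr_wpDl // mulr_ge0 // mulr_ge0.
exists (Num.min (d / 2) (e / K)); split; first by rewrite lt_min !divr_gt0.
move=> h; rewrite lt_min => /and3P[h0 hd2 heK].
have hn : h != 0 by rewrite -cmod_gt0.
have hd' : avoids w (z + h) (d / 2) by apply: avoids_near hd _; rewrite addrC addKr.
have d20 : 0 < d / 2 by rewrite divr_gt0.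
have c1 := cauchy_cvg hB d20 hd'; have c2 := cauchy_cvg hB d0 hd.
have c3 := cvgCB (cvgCZ h^-1 (cvgCB c1 c2)) tl.
pose s (q : C * C) := h * q.1 / ((z - q.2) ^+ 2 * (z + h - q.2)).
have {}c3 : cvgC (psum (fun k => \sum_(q <- w k) s q))
   ((cauchy w (z + h) - cauchy w z) / h - l).
  rewrite [_ / h]mulrC; apply: cvgC_ext c3 => n.
  rewrite -[X in _ * (_ - X)]mul1r -mulNr -[X in _ - X]mul1r -mulNr.
  rewrite /cterm !psum_blocksZ psum_blocks psum_blocksZ psum_blocks.
  apply: eq_psum_blocks => k q qw; rewrite /t /s.
  have n1 := avoids_neq d0 hd qw; have n2 := avoids_neq d20 hd' qw.
  by field; rewrite n1 n2.
apply: le_lt_trans (_ : cmod h * K < e); last by rewrite -ltr_pdivlMr.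
apply: cvgC_le c3 _ => n; apply: le_trans (cmod_sum _ _ _) _.
apply: le_trans (_ : (cmod h * (2 * d^-1 ^+ 3)) * B <= _); last first.
  by rewrite -mulrA ler_wpM2l ?cmod_ge0 // lerDl.
apply: blocks_le => // [|k q qw].
  by rewrite mulr_ge0 ?cmod_ge0 // mulr_ge0.
rewrite /s !cmodM cmodV cmodM cmodX mulrAC ler_wpM2r ?cmod_ge0//.
rewrite ler_wpM2l ?cmod_ge0 //.
have -> : 2 * d^-1 ^+ 3 = (d ^+ 2 * (d / 2))^-1 by field; lra.
have p1 := hd _ _ qw; have p2 := hd' _ _ qw.
have p0 : 0 < d ^+ 2 * (d / 2) by rewrite mulr_gt0 // exprn_gt0.
have p3 : d ^+ 2 * (d / 2) <= cmod (z - q.2) ^+ 2 * cmod (z + h - q.2).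
  apply: ler_pM => //; [by rewrite exprn_ge0 // ltW|exact: ltW|].
  by apply: lerXn2r => //; rewrite nnegrE ?cmod_ge0 ?ltW.
by rewrite lef_pV2 ?posrE //; exact: lt_le_trans p3.
Qed.

Lemma mass_shift w a (B d : R) m : mass_le w B -> 0 < d -> avoids w a d ->
  mass_le (shift a m w) (d^-1 ^+ m * B).
Proof.
move=> hB d0 hd n; apply: le_trans (_ : \sum_(k < n) d^-1 ^+ m * mass w k <= _).
  apply: ler_sum => k _; rewrite /mass big_map mulr_sumr.
  rewrite big_seq [leRHS]big_seq; apply: ler_sum => q qw /=.
  rewrite cmodM cmodV cmodX mulrC ler_wpM2r ?cmod_ge0//.
  rewrite -exprVn lerXn2r ?nnegrE ?invr_ge0 ?cmod_ge0 ?(ltW d0)//.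
  by rewrite cmod_distC lef_pV2 ?posrE ?(lt_le_trans d0)//; exact: hd qw.
by rewrite -mulr_sumr ler_wpM2l // exprn_ge0 // invr_ge0 ltW.
Qed.

Lemma avoids_shift w a z m (d : R) : avoids w z d -> avoids (shift a m w) z d.
Proof. by move=> h k q /mapP[p /h pd ->]. Qed.

Lemma cauchy_shift w a z (B d : R) m : mass_le w B -> 0 < d -> avoids w a d ->
  cmod (z - a) < d / 2 ->
  cauchy (shift a m w) z = cauchy (shift a m w) a + (z - a) * cauchy (shift a m.+1 w) z.
Proof.
move=> hB d0 hd za; have hz := avoids_near hd za.
have d20 : 0 < d / 2 by rewrite divr_gt0.
have c1 := cauchy_cvg (mass_shift m hB d0 hd) d20 (avoids_shift (a := a) (m := m) hz).
have c2 := cauchy_cvg (mass_shift m hB d0 hd) d0 (avoids_shift (a := a) (m := m) hd).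
have c3 := cauchy_cvg (mass_shift m.+1 hB d0 hd) d20 (avoids_shift (a := a) (m := m.+1) hz).
apply: cvgC_unique c1 _; apply: cvgC_ext (cvgCD c2 (cvgCZ (z - a) c3)) => n.
have E m' y : cterm (shift a m' w) y =
    fun k => \sum_(q <- w k) q.1 / (q.2 - a) ^+ m' / (y - q.2).
  by apply/funext => k; rewrite /cterm big_map.
rewrite !E psum_blocksZ psum_blocks; apply: eq_psum_blocks => k q qw.
have n1 := avoids_neq d0 hd qw; have n2 := avoids_neq d20 hz qw.
have n1' : q.2 - a != 0 by rewrite -opprB oppr_eq0.
rewrite exprS; have := expf_neq0 m n1'; move: (_ ^+ m) => x xn.
by field; rewrite n1 n2 n1' xn.
Qed.

Lemma shift0 w a : shift a 0 w = w.
Proof.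
apply/funext => k; rewrite /shift -[RHS]map_id; apply: eq_map => -[x y] /=.
by rewrite expr0 divr1.
Qed.

Lemma cauchy_shift_iter w a z (B d : R) m : mass_le w B -> 0 < d ->
  avoids w a d -> cmod (z - a) < d / 2 ->
  (forall j, (j < m)%N -> cauchy (shift a j w) a = 0) ->
  cauchy w z = (z - a) ^+ m * cauchy (shift a m w) z.
Proof.
move=> hB d0 hd za; elim: m => [|m ih] h0; first by rewrite shift0 mul1r.
rewrite ih => [|j jm]; last by apply: h0; rewrite ltnS ltnW.
by rewrite (cauchy_shift m hB d0 hd za) h0 // add0r mulrA -exprSr.
Qed.

(** Either every Taylor coefficient at [a] vanishes, and the remainders tend to 0 geometrically, or
    the first nonzero coefficient is the value at [a] of a holomorphic cofactor and its index is the
    order. *)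
Lemma cauchy_regular w a (B d : R) : mass_le w B -> 0 < d -> avoids w a d ->
  (locally_zero (cauchy w) a /\ cauchy w a = 0) \/
  exists m : nat, has_order (cauchy w) a m /\ (m = 0%N <-> cauchy w a != 0).
Proof.
move=> hB d0 hd; have d20 : 0 < d / 2 by rewrite divr_gt0.
have B0 := mass_le_ge0 hB.
have [[m hm]|h0] := pselect (exists m, cauchy (shift a m w) a != 0); last first.
  have {}h0 j : cauchy (shift a j w) a = 0.
    by apply/eqP/negPn/negP => e; apply: h0; exists j.
  left; split; last by rewrite -{1}[w](@shift0 _ a).
  exists (d / 2); split => // z /andP[z0 zd].
  apply/eqP/negPn/negP; rewrite -cmod_gt0 => c0.
  pose x := cmod (z - a) / d.
  have x0 : 0 <= x by rewrite divr_ge0 ?cmod_ge0 ?ltW.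
  have x1 : x <= 1 / 2 by rewrite ler_pdivrMr // ltW //; lra.
  (* The remainder of step m has mass at most B / d^m, its poles are d / 2 away from [z], and it is
     multiplied by |z - a|^m. *)
  have b m : cmod (cauchy w z) <= x ^+ m * ((d / 2)^-1 * B).
    rewrite (@cauchy_shift_iter _ _ _ _ _ m hB d0 hd zd) // cmodM cmodX.
    have := cauchy_le (mass_shift m hB d0 hd) d20 (avoids_shift (m := m) (avoids_near hd zd)).
    move/(ler_wpM2l (exprn_ge0 m (cmod_ge0 (z - a)))); move/le_trans; apply.
    by rewrite le_eqVlt; apply/orP; left; apply/eqP; rewrite /x expr_div_n exprVn; ring.
  have : (fun m => x ^+ m * ((d / 2)^-1 * B)) @ \oo --> (0 : R).
    rewrite -(mul0r ((d / 2)^-1 * B)); apply: cvgMr_tmp.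
    by apply: cvg_expr; rewrite ger0_norm //; lra.
  move=> /cvgrPdist_lt /(_ _ c0)[N _ /(_ N (leqnn N))] /=.
  rewrite sub0r normrN ger0_norm; first by rewrite ltNge b.
  exact: le_trans (ltW c0) (b N).
right; have /ex_minnP[{hm}m hm min] : exists m, cauchy (shift a m w) a != 0 by exists m.
exists m; have h0 j : (j < m)%N -> cauchy (shift a j w) a = 0.
  by move=> jm; apply/eqP/negPn/negP => /min; rewrite leqNgt jm.
split; last first.
  split=> [m0|]; first by move: hm; rewrite m0 shift0.
  by move=> e; apply/eqP; rewrite -leqn0; apply: min; rewrite shift0.
exists (d / 2); split => //; exists (cauchy (shift a m w)); split => [z zd|].
  apply: holo_cauchy (mass_shift m hB d0 hd) d20 _.
  by apply: avoids_shift; exact: avoids_near hd _.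
split=> // z /andP[_ zd]; rewrite -exprnP.
exact: cauchy_shift_iter hB d0 hd zd h0.
Qed.

(** Removing the entries with pole [a] leaves data [w'] whose sum is regular at [a]; then (z - a)
    times the function is g + (z - a) [cauchy w' z], with value g at [a]. *)
Lemma cauchy_pole w a (B d : R) k0 : mass_le w B -> 0 < d ->
  (forall k q, q \in w k -> q.2 != a -> d <= cmod (a - q.2)) ->
  (forall k, k != k0 -> forall q, q \in w k -> q.2 != a) ->
  \sum_(q <- w k0 | q.2 == a) q.1 != 0 ->
  has_order (cauchy w) a (-1).
Proof.
move=> hB d0 hd hk; set g := \sum_(q <- w k0 | _) _ => g0.
pose w' k := [seq q <- w k | q.2 != a].
have hB' : mass_le w' B.
  move=> n; apply: le_trans (hB n); apply: ler_sum => k _.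
  rewrite /mass big_filter [leRHS](bigID (fun q => q.2 == a)) /= lerDr.
  by rewrite sumr_ge0 // => q _; exact: cmod_ge0.
have hd' : avoids w' a d.
  by move=> k q; rewrite mem_filter => /andP[+ h]; exact: hd h.
have d20 : 0 < d / 2 by rewrite divr_gt0.
have E z : cmod (z - a) < d / 2 -> cauchy w z = g / (z - a) + cauchy w' z.
  move=> zd; apply: csum_def; have c := cauchy_cvg hB' d20 (avoids_near hd' zd).
  apply: cvgC_eventually (cvgCD (cvgC_cst (g / (z - a))) c) _.
  (* From this index on the partial sums contain block [k0], hence the whole polar part. *)
  exists k0.+1 => n kn; rewrite /psum.
  have -> : g / (z - a) = \sum_(k < n) \sum_(q <- w k | q.2 == a) q.1 / (z - q.2).
    rewrite (bigD1 (Ordinal kn)) //= [X in _ = _ + X]big1 ?addr0 => [|k kk0].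
      by rewrite /g mulr_suml; apply: eq_bigr => q /eqP ->.
    rewrite big_seq_cond big1 // => q /andP[qw qa].
    by have := hk k kk0 q qw; rewrite qa.
  rewrite -big_split; apply: eq_bigr => k _.
  by rewrite /cterm (bigID (fun q => q.2 == a)) /= big_filter.
exists (d / 2); split=> //; exists (fun z => g + (z - a) * cauchy w' z); split.
  move=> z zd; apply: holo_at_affineM; apply: holo_cauchy hB' d20 _.
  exact: avoids_near hd' _.
split; first by rewrite subrr mul0r addr0.
move=> z /andP[z0 zd]; have zn : z - a != 0 by rewrite -cmod_gt0.
by rewrite E // exprN1 mulrDr mulKf // mulrC.
Qed.

End CauchySums.

(** * Proximity function *)

Section Integrals.
Set Implicit Arguments. Unset Strict Implicit.

Import HBNNSimple.

(* No measurability of [f1] or [f2] is needed: the integral of a nonnegative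
   function is a supremum over simple functions below it. *)
Lemma ge0_le_integral_sup d (T : measurableType d) (R : realType)
    (mu : {measure set T -> \bar R}) (D : set T) (f1 f2 : T -> \bar R) :
  (forall x, D x -> (0 <= f1 x)%E) -> (forall x, D x -> (f1 x <= f2 x)%E) ->
  (\int[mu]_(x in D) f1 x <= \int[mu]_(x in D) f2 x)%E.
Proof.
move=> f10 f12; rewrite !(integral_mkcond D).
have h12 x : ((f1 \_ D) x <= (f2 \_ D) x)%E by apply: lee_restrict.
have h10 x : (0 <= (f1 \_ D) x)%E by apply: erestrict_ge0.
rewrite !ge0_integralTE//; last by move=> x; apply: le_trans (h10 x) (h12 x).
apply: ereal_sup_le => _ [h /= hf <-].
by exists h => // x; exact: le_trans (hf x) (h12 x).
Qed.

Variable R : realType.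
Local Notation mu := (@lebesgue_measure R).
Implicit Types (c t r x : R).

(** The radius shrinks by 4 while the weight 2^j doubles, which matches the power -1/2. The first
    radius is 4 so that a half circle of angles, of length pi, is covered. *)
Definition ivl c (j : nat) : set R := `[c - 4 * 4^-1 ^+ j, c + 4 * 4^-1 ^+ j]%classic.

Definition ivl_term c j t : R := 2 ^+ j * \1_(ivl c j) t.

(* A dyadic step function above [|t - c|^(-1/2)] near [c]: its integral is a
   geometric series, so no improper integral has to be computed. *)
Definition sqrt_majorant c t : \bar R := (\sum_(j <oo) (ivl_term c j t)%:E)%E.

Lemma ivl_measure c j : mu (ivl c j) = (8 * 4^-1 ^+ j)%:E.
Proof.
have h : 0 < (4^-1 : R) ^+ j by rewrite exprn_gt0.
rewrite /ivl lebesgue_measure_itv /= lte_fin ifT; last by lra.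
by rewrite -EFinB; congr (_%:E); ring.
Qed.

Lemma ivl_term_ge0 c j t : 0 <= ivl_term c j t.
Proof. by rewrite /ivl_term mulr_ge0 // ?exprn_ge0. Qed.

Lemma ivl_term_measurable c j (D : set R) :
  measurable_fun D (EFin \o ivl_term c j).
Proof.
apply/measurable_EFinP; apply: measurable_funM => //.
by apply: measurable_indic; exact: measurable_itv.
Qed.

Lemma sqrt_majorant_ge0 c t : (0 <= sqrt_majorant c t)%E.
Proof. by apply: nneseries_ge0 => j _ _; rewrite lee_fin ivl_term_ge0. Qed.

Lemma sqrt_majorant_measurable c (D : set R) : measurable_fun D (sqrt_majorant c).
Proof.
apply: ge0_emeasurable_sum => [k x _ _|k _]; first by rewrite lee_fin ivl_term_ge0.
exact: ivl_term_measurable.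
Qed.

(** Term j has integral at most 2^j * 8 * 4^-j = 8 * 2^-j. *)
Lemma sqrt_majorant_integral c (D : set R) : measurable D ->
  (\int[mu]_(t in D) sqrt_majorant c t <= 16%:E)%E.
Proof.
move=> mD; rewrite integral_nneseries //; last 2 first.
- by move=> n; exact: ivl_term_measurable.
- by move=> n x _; rewrite lee_fin ivl_term_ge0.
apply: lime_le.
  by apply: is_cvg_nneseries => n _ _; apply: integral_ge0 => x _; rewrite lee_fin ivl_term_ge0.
apply: nearW => n; apply: le_trans (_ : (\sum_(0 <= j < n) (8 * 2^-1 ^+ j)%:E <= _)%E).
  apply: lee_sum => j _; under eq_integral do rewrite /ivl_term EFinM.
  rewrite ge0_integralZl //; last first.
    by apply/measurable_EFinP; apply: measurable_indic; exact: measurable_itv.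
  rewrite integral_indic //; last exact: measurable_itv.
  apply: le_trans (_ : (2 ^+ j)%:E * mu (ivl c j) <= _)%E.
    apply: lee_wpmul2l; first by rewrite lee_fin exprn_ge0.
    by apply: le_measure; rewrite ?inE; [apply: measurableI => //; exact: measurable_itv|exact: measurable_itv|exact: subIsetl].
  rewrite ivl_measure -EFinM lee_fin mulrCA -exprMn.
  by rewrite (_ : 2 * 4^-1 = 2^-1 :> R) //; lra.
rewrite sumEFin lee_fin -mulr_sumr.
have -> : \sum_(0 <= j < n) (2^-1 : R) ^+ j = 2 - 2 * 2^-1 ^+ n.
  elim: n => [|n ih]; first by rewrite big_geq // expr0; lra.
  by rewrite big_nat_recr //= ih exprS; lra.
have : 0 <= (2^-1 : R) ^+ n by rewrite exprn_ge0.
lra.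
Qed.

(** For 0 < x < 1 take j with 4^-(j+1) < x <= 4^-j. Then [t] lies in [ivl c j], and 1 / sqrt x <=
    2^(j+1) is twice the weight of that interval. *)
Lemma sqrt_majorantP c t x : `|t - c| <= 4 -> `|t - c| <= 4 * x ->
  (((Num.sqrt x)^-1)%:E <= 2%:E * sqrt_majorant c t)%E.
Proof.
move=> t4 tx.
have key j : (Num.sqrt x)^-1 <= 2 * 2 ^+ j -> `|t - c| <= 4 * 4^-1 ^+ j ->
    (((Num.sqrt x)^-1)%:E <= 2%:E * sqrt_majorant c t)%E.
  move=> h1 h2; apply: (@le_trans _ _ (2%:E * (2 ^+ j)%:E)%E).
    by rewrite -EFinM lee_fin.
  apply: lee_wpmul2l => //; rewrite /sqrt_majorant.
  apply: le_trans (nneseries_lim_ge j.+1 _); last first.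
    by move=> k _ _; rewrite lee_fin ivl_term_ge0.
  rewrite big_nat_recr //= {2}/ivl_term indicE mem_set ?mulr1; last first.
    by rewrite /ivl /= in_itv /=; move: h2; rewrite ler_norml; lra.
  by rewrite leeDr // sume_ge0 // => k _; rewrite lee_fin ivl_term_ge0.
have [x1|x1] := lerP 1 x.
  apply: (key 0%N); rewrite !expr0 ?mulr1 //.
  apply: le_trans (_ : 1 <= _); last by lra.
  by rewrite invf_le1 ?sqrtr_gt0 ?(lt_le_trans ltr01) // -sqrtr1 ler_wsqrtr.
(* This covers a point of the circle equal to the pole: there the inverse square root is 0 by the
   convention [0^-1 = 0]. *)
have [x0|x0] := lerP x 0.
  by apply: (key 0%N); rewrite ?ler0_sqrtr ?invr0 ?expr0 ?mulr1.
have ex : exists j, (4^-1 : R) ^+ j.+1 < x.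
  have : (fun j => (4^-1 : R) ^+ j) @ \oo --> (0 : R).
    by apply: cvg_expr; rewrite ger0_norm //; lra.
  move=> /cvgrPdist_lt /(_ _ x0)[N _ /(_ N.+1 (leqnSn N))] /=.
  by rewrite sub0r normrN ger0_norm ?exprn_ge0 // => h; exists N.
case: (ex_minnP ex) => j hj min.
have xj : x <= 4^-1 ^+ j.
  case: j hj min => [|j] hj min; first by rewrite expr0 ltW.
  by rewrite leNgt; apply/negP => /min; rewrite ltnn.
apply: (key j); last by apply: le_trans tx _; rewrite ler_wpM2l.
rewrite -exprS -[leRHS]invrK lef_pV2 ?posrE ?invr_gt0 ?exprn_gt0 ?sqrtr_gt0//.
rewrite -exprVn; apply: le_trans (_ : Num.sqrt (4^-1 ^+ j.+1) <= _); last first.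
  by rewrite ler_wsqrtr // ltW.
have -> : 4^-1 = 2^-1 ^+ 2 :> R by field.
by rewrite exprAC sqrtr_sqr ger0_norm ?exprn_ge0.
Qed.

End Integrals.

(** * From the distance to one pole to a bound on the proximity function *)

Section Proximity.
Set Implicit Arguments. Unset Strict Implicit.
Variable R : realType.
Local Notation C := (R[i]).
Local Notation mu := (@lebesgue_measure R).
Implicit Types (c t s r x u : R).

(** Write sin x = 2 sin(x/2) cos(x/2) and sin(x/2) = (x/2) cos y by the mean value theorem. Both
    cosines are at least cos(pi/4), whose square is 1/2. *)
Lemma half_le_sin x : 0 <= x <= pi / 2 -> x / 2 <= sin x.
Proof.
move=> /andP[x0 xp]; have p0 := pi_gt0 R.
pose k : R := cos (pi / 4).
have k2 : k ^+ 2 = 2^-1.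
  have := cos_mulr2n (pi / 4 : R); rewrite (_ : pi / 4 *+ 2 = pi / 2); last by field.
  by rewrite cos_pihalf -/k; lra.
have k0 : 0 < k by apply: cos_gt0_pihalf; lra.
have kcos y : 0 <= y <= pi / 4 -> k <= cos y.
  rewrite le_eqVlt => /andP[y0]; rewrite le_eqVlt => /orP[/eqP->//|yp].
  apply/ltW; rewrite ltr_cos ?in_itv //=; first by lra.
  by move: y0; rewrite -le_eqVlt => ?; lra.
have [y yI sE] : exists2 y, y \in `[0, x / 2]%R & sin (x / 2) - sin 0 = cos y * (x / 2 - 0).
  apply: MVT_segment; first by lra.
  exact: (continuous_subspaceT (@continuous_sin R)).
have := sin_mulr2n (x / 2); rewrite (_ : x / 2 *+ 2 = x); last by field.
move: sE; rewrite sin0 !subr0 => -> ->.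
move: yI; rewrite in_itv /= => yI.
have h1 : k <= cos y by apply: kcos; lra.
have h2 : k <= cos (x / 2) by apply: kcos; lra.
have : k * k <= cos (x / 2) * cos y by apply: ler_pM => //; exact: ltW.
rewrite -expr2 k2 mulrA => h3.
have : 2^-1 * (x / 2) <= cos (x / 2) * cos y * (x / 2) by apply: ler_wpM2r => //; lra.
by rewrite -[_ *+ 2]mulr_natl; lra.
Qed.

Lemma sqr_cmod (z : C) : cmod z ^+ 2 = complex.Re z ^+ 2 + complex.Im z ^+ 2.
Proof. by rewrite sqr_sqrtr // addr_ge0 // sqr_ge0. Qed.

(** The chord has length 2 r sin v with v = |t - s| / 2 in [0, pi/2], and sin v >= v / 2. *)
Lemma dist_le_circ r t s : 1 <= r -> `|t - s| <= pi ->
  `|t - s| <= 2 * cmod (circ r t - circ r s).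
Proof.
move=> r1 tsp; rewrite -ler_sqr ?nnegrE ?mulr_ge0 ?cmod_ge0//.
pose v := `|t - s| / 2.
have v0 : 0 <= v by rewrite divr_ge0.
have vs : v / 2 <= sin v by apply: half_le_sin; rewrite v0 /v; lra.
have cE : cos (t - s) = 1 - 2 * sin v ^+ 2.
  have -> : cos (t - s) = cos (v *+ 2).
    by rewrite -(cos_norm (t - s)); congr cos; rewrite /v; field.
  by rewrite cos_mulr2n sin2cos2; ring.
have -> : (2 * cmod (circ r t - circ r s)) ^+ 2 = r ^+ 2 * (4 * sin v) ^+ 2.
  rewrite exprMn sqr_cmod /=.
  have a1 := cos2Dsin2 t; have a2 := cos2Dsin2 s; rewrite cosB in cE.
  have -> : (r * cos t - r * cos s) ^+ 2 + (r * sin t - r * sin s) ^+ 2 =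
     r ^+ 2 * ((cos t ^+ 2 + sin t ^+ 2) + (cos s ^+ 2 + sin s ^+ 2)
       - 2 * (cos t * cos s + sin t * sin s)) by ring.
  by rewrite a1 a2 cE; ring.
have -> : `|t - s| = 2 * v by rewrite /v; field.
have h : (2 * v) ^+ 2 <= (4 * sin v) ^+ 2.
  by apply: lerXn2r; rewrite ?nnegrE; lra.
apply: le_trans h _; rewrite ler_peMl ?sqr_ge0 //.
by rewrite -[1](expr1n _ 2); apply: lerXn2r; rewrite ?nnegrE; lra.
Qed.

(** Let [c] minimise the distance to [p] on the half circle. The chord from [t] to [c] is then at
    most twice the distance from [t] to [p], and [dist_le_circ] gives another factor 2; a half
    circle keeps the angles within pi. *)
Lemma closest_angle r u (p : C) : 1 <= r -> exists2 c, c \in `[u, u + pi]%R &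
  forall t, t \in `[u, u + pi]%R -> `|t - c| <= 4 * cmod (circ r t - p).
Proof.
move=> r1; have p0 := pi_gt0 R.
pose f t := (r * cos t - complex.Re p) ^+ 2 + (r * sin t - complex.Im p) ^+ 2.
have cf : {within `[u, u + pi], continuous f}.
  apply: continuous_subspaceT => t.
  have cc : (fun t => r * cos t - complex.Re p) x @[x --> t] --> r * cos t - complex.Re p.
    by apply: cvgB; [apply: cvgMl_tmp; exact: continuous_cos|exact: cvg_cst].
  have cs : (fun t => r * sin t - complex.Im p) x @[x --> t] --> r * sin t - complex.Im p.
    by apply: cvgB; [apply: cvgMl_tmp; exact: continuous_sin|exact: cvg_cst].
  rewrite /f; apply: cvgD.
  - by under eq_fun do rewrite expr2; rewrite expr2; exact: cvgM.
  - by under eq_fun do rewrite expr2; rewrite expr2; exact: cvgM.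
have [c cI cmin] := @EVT_min R f u (u + pi) ltac:(lra) cf.
exists c => // t tI.
have fE x : f x = cmod (circ r x - p) ^+ 2.
  by rewrite sqr_cmod; case: p @f cf cmin => a b.
have {}cmin : cmod (circ r c - p) <= cmod (circ r t - p).
  by rewrite -ler_sqr ?nnegrE ?cmod_ge0// -!fE; exact: cmin.
have tc : `|t - c| <= pi.
  by move: cI tI; rewrite !in_itv /= ler_norml; lra.
apply: le_trans (dist_le_circ r1 tc) _.
have -> : circ r t - circ r c = (circ r t - p) - (circ r c - p) by ring.
have := cmodD (circ r t - p) (- (circ r c - p)); rewrite cmodN.
lra.
Qed.

Lemma pi_le4 : pi <= 4 :> R.
Proof. by have := pihalf_lt2 R; lra. Qed.

(* One majorant per half circle, centred at the angle of its point closest to [p]. *)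
Lemma circle_majorant r (p : C) : 1 <= r -> exists G : R -> \bar R,
  [/\ forall t, (0 <= G t)%E,
      forall D : set R, measurable_fun D G,
      forall t, t \in `[0, 2 * pi]%R -> (((Num.sqrt (cmod (circ r t - p)))^-1)%:E <= G t)%E &
      (\int[mu]_(t in `[0%R, (2 * pi)%R]) G t <= 64%:E)%E].
Proof.
move=> r1; have p4 := pi_le4.
have [c1 c1I h1] := closest_angle 0 p r1.
have [c2 c2I h2] := closest_angle pi p r1.
have G0 c t : (0 <= 2%:E * sqrt_majorant c t)%E by rewrite mule_ge0 // sqrt_majorant_ge0.
have mG c D : measurable_fun D (fun t => 2%:E * sqrt_majorant c t)%E.
  by apply: measurable_funeM; exact: sqrt_majorant_measurable.
have mI : measurable (`[0%R, (2 * pi)%R]%classic : set R) by exact: measurable_itv.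
exists (fun t => 2%:E * sqrt_majorant c1 t + 2%:E * sqrt_majorant c2 t)%E; split.
- by move=> t; apply: adde_ge0; exact: G0.
- by move=> D; exact: emeasurable_funD.
- move=> t; rewrite in_itv /= => tI; have [tp|tp] := lerP t pi.
    have tI' : t \in `[0, 0 + pi]%R by rewrite in_itv /=; lra.
    apply: (@le_trans _ _ (2%:E * sqrt_majorant c1 t)%E); last by rewrite leeDl.
    apply: sqrt_majorantP; last exact: h1.
    by move: c1I tI'; rewrite !in_itv /= ler_norml; lra.
  have tI' : t \in `[pi, pi + pi]%R by rewrite in_itv /=; lra.
  apply: (@le_trans _ _ (2%:E * sqrt_majorant c2 t)%E); last by rewrite leeDr.
  apply: sqrt_majorantP; last exact: h2.
  by move: c2I tI'; rewrite !in_itv /= ler_norml; lra.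
- rewrite ge0_integralD //; try exact: mG.
  have b c : (\int[mu]_(t in `[0%R, (2 * pi)%R]) (2%:E * sqrt_majorant c t) <= 32%:E)%E.
    rewrite ge0_integralZl //; last 2 first.
    - exact: sqrt_majorant_measurable.
    - by move=> x _; exact: sqrt_majorant_ge0.
    apply: (@le_trans _ _ (2%:E * 16%:E)%E).
      by apply: lee_wpmul2l => //; exact: sqrt_majorant_integral.
    by rewrite -EFinM lee_fin; lra.
  apply: le_trans (leeD (b c1) (b c2)) _.
  by rewrite -EFinD lee_fin; lra.
Qed.

(** Subadditivity of the square root in squared form: it is applied with [F] a square root of a
    modulus. *)
Lemma sum_sqr_le (I : Type) (l : seq I) (F : I -> R) : (forall i, 0 <= F i) ->
  \sum_(i <- l) F i ^+ 2 <= (\sum_(i <- l) F i) ^+ 2.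
Proof.
move=> F0; elim: l => [|i l ih]; first by rewrite !big_nil expr0n.
have h : 0 <= \sum_(j <- l) F j by apply: sumr_ge0.
rewrite !big_cons; have := mulr_ge0 (F0 i) h; move: ih.
by rewrite sqrrD; lra.
Qed.

(** For s > 0, ln(s^2) = 2 ln s <= 2 (s - 1). *)
Lemma logplus_le x s : 0 <= s -> x <= s ^+ 2 -> logplus x <= 2 * s.
Proof.
move=> s0 xs; rewrite /logplus ge_max mulr_ge0 //=.
have [x0|x0] := lerP x 0; first by rewrite ln0 // mulr_ge0.
have s1 : 0 < s.
  rewrite lt_def s0 andbT; apply/eqP => s00.
  by move: (lt_le_trans x0 xs); rewrite s00 expr0n ltxx.
apply: le_trans (_ : ln (s ^+ 2) <= _); first by rewrite ler_ln // posrE exprn_gt0.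
rewrite lnXn // -[_ *+ 2]mulr_natl ler_wpM2l //.
by have := le_ln1Dx (x := s - 1) ltac:(lra); rewrite addrC subrK; lra.
Qed.

Lemma cmod_cauchy_le (w : nat -> seq (C * C)) (z : C) (S : R) :
  (forall n, \sum_(k < n) \sum_(q <- w k)
     Num.sqrt (cmod q.1) * (Num.sqrt (cmod (z - q.2)))^-1 <= S) ->
  cmod (cauchy w z) <= S ^+ 2.
Proof.
move=> h; apply: csum_le => n.
pose F (q : C * C) := Num.sqrt (cmod q.1) * (Num.sqrt (cmod (z - q.2)))^-1.
have F0 q : 0 <= F q by rewrite mulr_ge0 // ?invr_ge0 sqrtr_ge0.
have F1 k : 0 <= \sum_(q <- w k) F q by apply: sumr_ge0.
apply: le_trans (_ : (\sum_(k < n) \sum_(q <- w k) F q) ^+ 2 <= _); last first.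
  apply: lerXn2r; last exact: h; rewrite nnegrE; first exact: sumr_ge0.
  by apply: le_trans _ (h 0%N); rewrite big_ord0.
apply: le_trans _ (sum_sqr_le _ _) => //; apply: ler_sum => k _.
apply: le_trans (cmod_sum _ _ _) _; apply: le_trans _ (sum_sqr_le _ F0).
 apply: ler_sum => q _; rewrite cmodM cmodV exprMn exprVn !sqr_sqrtr ?cmod_ge0 //.
Qed.

(** Along the circle log+ of the sum is at most 2 [E], where [E] adds sqrt |c| times the circle
    majorant of each pole. Termwise integration of [E] costs at most 64 sqrt |c| per pole, uniformly
    in r. *)
Lemma proximity_cauchy (w : nat -> seq (C * C)) (S r : R) :
  (forall n, \sum_(k < n) \sum_(q <- w k) Num.sqrt (cmod q.1) <= S) -> 1 <= r ->
  (proximity (cauchy w) r <= (64 * S)%:E)%E.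
Proof.
move=> hS r1; have p2 := pi_ge2 R.
have [G hG] := choice (fun p => circle_majorant p r1).
have S0 : 0 <= S by apply: le_trans _ (hS 0%N); rewrite big_ord0.
have mI : measurable (`[0%R, (2 * pi)%R]%classic : set R) by exact: measurable_itv.
pose T (q : C * C) t := ((Num.sqrt (cmod q.1))%:E * G q.2 t)%E.
have T0 q t : (0 <= T q t)%E.
  by have [g0 _ _ _] := hG q.2; rewrite mule_ge0 // lee_fin sqrtr_ge0.
have mT q (D : set R) : measurable_fun D (T q).
  by have [_ mg _ _] := hG q.2; exact: measurable_funeM.
pose U k t := (\sum_(q <- w k) T q t)%E.
have U0 k t : (0 <= U k t)%E by exact: sume_ge0.
have mU k (D : set R) : measurable_fun D (U k) by exact: emeasurable_sum.
pose E t := (\sum_(k <oo) U k t)%E.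
have E0 t : (0 <= E t)%E by exact: nneseries_ge0.
have mE (D : set R) : measurable_fun D E by exact: ge0_emeasurable_sum.
have iE : (\int[mu]_(t in `[0%R, (2 * pi)%R]) E t <= (64 * S)%:E)%E.
  rewrite integral_nneseries //; last by move=> n; exact: mU.
  apply: lime_le.
    by apply: is_cvg_nneseries => n _ _; exact: integral_ge0.
  apply: nearW => n.
  apply: (@le_trans _ _ (\sum_(0 <= k < n) (64 * \sum_(q <- w k) Num.sqrt (cmod q.1))%:E)%E).
    apply: lee_sum => k _; rewrite ge0_integral_sum //; last by move=> q; exact: mT.
    rewrite mulr_sumr -sumEFin.
    apply: lee_sum => q _; have [g0 mg _ gi] := hG q.2.
    rewrite ge0_integralZl //; last exact: mg.
    rewrite [64 * _]mulrC EFinM; exact: lee_wpmul2l.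
  by rewrite sumEFin lee_fin -mulr_sumr ler_wpM2l // big_mkord.
have pt t : (`[0%R, (2 * pi)%R]%classic : set R) t ->
    ((logplus (cmod (cauchy w (circ r t))))%:E <= 2%:E * E t)%E.
  (* Where [E t] is infinite the bound is trivial; elsewhere its finite value s dominates all
     partial sums. *)
  move=> tI; have := E0 t; case eE : (E t) => [s| |] // s0; last first.
    by rewrite mulry gtr0_sg // mul1e leey.
  rewrite lee_fin in s0; rewrite -EFinM lee_fin; apply: logplus_le => //.
  apply: cmod_cauchy_le => n; rewrite -lee_fin -eE.
  apply: le_trans _ (nneseries_lim_ge n _); last by move=> k _ _; exact: U0.
  rewrite big_mkord -sumEFin; apply: lee_sum => k _; rewrite -sumEFin.
  apply: lee_sum => q _; have [_ _ g1 _] := hG q.2.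
  by rewrite EFinM; apply: lee_wpmul2l; [rewrite lee_fin sqrtr_ge0|exact: g1].
have i0 : (0 <= \int[mu]_(t in `[0%R, (2 * pi)%R]) E t)%E by exact: integral_ge0.
rewrite /proximity.
(* The 2 from [logplus_le] is absorbed by the factor 1 / (2 pi) of the mean. *)
apply: (@le_trans _ _ (((2 * pi)^-1)%:E * (2%:E * (64 * S)%:E))%E); last first.
  rewrite -!EFinM lee_fin mulrA ler_piMl ?mulr_ge0 //.
  by rewrite mulrC ler_pdivrMr; lra.
apply: lee_wpmul2l; first by rewrite lee_fin invr_ge0; lra.
apply: le_trans (_ : (\int[mu]_(t in `[0%R, (2 * pi)%R]) (2%:E * E t) <= _)%E).
  apply: ge0_le_integral_sup => // t _.
  by rewrite lee_fin /logplus le_max lexx.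
by rewrite ge0_integralZl //; [apply: lee_wpmul2l|exact: mE].
Qed.

End Proximity.

(** * Counting function *)

Section Counting.
Set Implicit Arguments. Unset Strict Implicit.
Variable R : realType.
Local Notation C := (R[i]).
Local Notation mu := (@lebesgue_measure R).
Implicit Types (f : C -> C) (r t M : R).

Lemma pole_mult_ge0 f a : 0 <= pole_mult f a.
Proof. by rewrite /pole_mult ler0z le_max lexx. Qed.

Lemma npoles_ge0 f t : 0 <= npoles f t.
Proof. by apply: fsumr_ge0 => a _; exact: pole_mult_ge0. Qed.

(** The list [L'] contains the support of the sum over the disc, which thereby becomes a finite sum
    of terms at most 1. *)
Lemma npoles_le f (L : seq C) t :
  (forall a, cmod a <= t -> pole_mult f a != 0 -> a \in L) ->
  (forall a, pole_mult f a <= 1) -> npoles f t <= (size L)%:R.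
Proof.
move=> hL h1; pose L' := [seq a <- undup L | cmod a <= t].
rewrite /npoles fsbig_supp (fsbig_fwiden L').
- apply: le_trans (_ : \sum_(a <- L') 1 <= _); first by apply: ler_sum => a _; exact: h1.
  rewrite big_const_seq count_predT iter_addr addr0 ler_nat size_filter.
  by apply: leq_trans (count_size _ _) (size_undup _).
- move=> a [/= at_ /eqP an]; rewrite mem_filter at_ mem_undup; exact: hL.
- by rewrite filter_uniq // undup_uniq.
- move=> a /= []; rewrite mem_filter => /andP[at_ _] /not_andP[//|].
  by move=> /contrapT.
Qed.

Lemma npoles0 f t : (forall a, cmod a <= t -> pole_mult f a = 0) -> npoles f t = 0.
Proof. by move=> h; apply: fsbig1 => a /= /h. Qed.

Lemma integral_inv_ln M r : 1 < r ->
  (\int[mu]_(t in `[1%R, r]) (M / t)%:E = (M * ln r)%:E)%E.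
Proof.
move=> r1; rewrite (@continuous_FTC2 _ (fun t => M / t) (fun t => M * ln t)) //.
- by rewrite ln1 mulr0 sube0.
- apply: continuous_in_subspaceT => t; rewrite inE /= in_itv /= => /andP[t1 _].
  by apply: cvgMl_tmp; apply: inv_continuous; rewrite gt_eqF // (lt_le_trans ltr01).
- have cl t : 1 <= t -> {for t, continuous (fun t => M * ln t)}.
    by move=> t1; apply: cvgMl_tmp; apply: continuous_ln; rewrite (lt_le_trans ltr01).
  split.
  + move=> t; rewrite in_itv /= => /andP[t1 _].
    have t0 : 0 < t by rewrite (lt_trans ltr01).
    by have [] := is_deriveZ M (is_derive1_ln t0).
  + exact: cvg_at_right_filter (cl 1 (lexx 1)).
  + exact: cvg_at_left_filter (cl r (ltW r1)).
- move=> t; rewrite in_itv /= => /andP[t1 _].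
  have t0 : 0 < t by rewrite (lt_trans ltr01).
  by rewrite derive1E; have [_ ->] := is_deriveZ M (is_derive1_ln t0).
Qed.

Lemma counting_le_linear f M r : npoles f 0 = 0 -> 0 <= M -> 0 < r ->
  (forall t, 0 < t -> npoles f t <= M * t) -> (Defs.counting f r <= (M * r)%:E)%E.
Proof.
move=> n0 M0 r0 h; rewrite /Defs.counting n0 mul0r adde0.
apply: le_trans (_ : (\int[mu]_(t in `]0%R, r]) M%:E <= _)%E).
  apply: ge0_le_integral_sup => t /=; rewrite in_itv /= => /andP[t0 _].
    by rewrite lee_fin subr0 divr_ge0 ?npoles_ge0 // ltW.
  by rewrite lee_fin subr0 ler_pdivrMr // h.
rewrite integral_cst; last exact: measurable_itv.
by rewrite /= lebesgue_measure_itv /= lte_fin r0 -EFinD oppr0 addr0 -EFinM.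
Qed.

(** With no poles in the open unit disc the integrand vanishes below 1, and what remains is at most
    the integral of M / t from 1 to r. *)
Lemma counting_le_log f M r : (forall t, t < 1 -> npoles f t = 0) -> 1 < r ->
  (forall t, t <= r -> npoles f t <= M) -> (Defs.counting f r <= (M * ln r)%:E)%E.
Proof.
move=> n0 r1 h; rewrite /Defs.counting n0 // mul0r adde0 -integral_inv_ln //.
have M0 : 0 <= M by apply: le_trans (npoles_ge0 f r) (h _ _).
(* The two domains differ, so both integrands are extended by 0 and compared on the whole line. *)
rewrite integral_mkcond [leRHS]integral_mkcond.
have f0 t : `]0%R, r]%classic t -> (0 <= ((npoles f t - 0) / t)%:E)%E.
  rewrite /= in_itv /= => /andP[t0 _].
  by rewrite lee_fin subr0 divr_ge0 ?npoles_ge0 // ltW.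
apply: ge0_le_integral_sup => t _; first exact: erestrict_ge0.
rewrite /patch; case: ifPn => [|_]; rewrite ?inE /= ?in_itv /=.
  move=> /andP[t0 tr]; have [t1|t1] := ltP t 1.
    rewrite n0 // subr0 mul0r; case: ifP => //; rewrite inE /= in_itv /= => /andP[t1' _].
    by rewrite lee_fin divr_ge0 // ltW.
  rewrite ifT ?inE /= ?in_itv /= ?t1 ?tr //.
  by rewrite lee_fin subr0 ler_wpM2r ?h // invr_ge0 ltW.
case: ifP => //; rewrite inE /= in_itv /= => /andP[t1' _].
by rewrite lee_fin divr_ge0 // (le_trans ler01).
Qed.

End Counting.

(** * Partial fractions of an infinite product *)

Section Interpolation.
Set Implicit Arguments. Unset Strict Implicit.

(* The induction step uses the induction hypothesis a second time, at
   [w = - a N], to identify the coefficient of the new term. *)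
Lemma inv_prod_partial_fractions (F : fieldType) (a : nat -> F) (N : nat) (w : F) :
  (forall i, a i != 0) -> injective a ->
  (forall i, (i < N.+1)%N -> 1 + w / a i != 0) ->
  \prod_(j < N.+1) (1 + w / a j)^-1 =
  \sum_(k < N.+1) (\prod_(j < N.+1 | j != k :> nat) (1 - a k / a j)^-1) * (1 + w / a k)^-1.
Proof.
move=> a0 ainj; have dist i j : i != j -> 1 - a i / a j != 0.
  move=> ij; rewrite subr_eq0; apply/eqP => e.
  have : a i = a j by rewrite -[LHS](divfK (a0 j)) -e mul1r.
  by move/ainj/eqP; rewrite (negbTE ij).
elim: N w => [|N ih] w hw.
  by rewrite !big_ord1 (big_pred0 _ _ _ _ (fun j : 'I_1 => _)) ?mul1r // => j; rewrite ord1.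
have hw' i : (i < N.+1)%N -> 1 + w / a i != 0 by move=> iN; apply: hw; rewrite ltnW.
rewrite big_ord_recr /= ih // [RHS]big_ord_recr /=.
have step k : (k < N.+1)%N ->
    \prod_(j < N.+2 | j != k :> nat) (1 - a k / a j)^-1 =
    (\prod_(j < N.+1 | j != k :> nat) (1 - a k / a j)^-1) * (1 - a k / a N.+1)^-1.
  by move=> kN; rewrite big_mkcond big_ord_recr /= -big_mkcond /= gtn_eqF.
have last_ : \prod_(j < N.+2 | j != N.+1 :> nat) (1 - a N.+1 / a j)^-1 =
    \prod_(j < N.+1) (1 + - a N.+1 / a j)^-1.
  rewrite big_mkcond big_ord_recr /= eqxx mulr1; apply: eq_bigr => j _.
  by rewrite ltn_eqF // mulNr.
rewrite last_ (ih (- a N.+1)); last first.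
  by move=> i iN; rewrite mulNr dist // gtn_eqF.
rewrite mulr_suml [X in _ = _ + X]mulr_suml -big_split /=; apply: eq_bigr => k _.
rewrite step //; have kN : (k : nat) != N.+1 by rewrite ltn_eqF.
have h1 := hw' k (ltn_ord k); have h2 := hw N.+1 (ltnSn _).
have h3 := dist _ _ kN; have h4 : 1 - a N.+1 / a k != 0 by rewrite dist // eq_sym.
move: (\prod_(_ < _ | _) _) => P; rewrite mulNr.
have ak := a0 k; have aN := a0 N.+1.
move: h1 h2 h3 h4 ak aN; move: (a k) (a N.+1) => x y h1 h2 h3 h4 x0 y0.
(* The nonvanishing factors are rewritten without fractions, as the denominators that [field]
   produces. *)
have g1 : x + w != 0 by apply: contraNneq h1 => e; rewrite -(mulfK x0 1) mul1r -mulrDl e mul0r.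
have g2 : y + w != 0 by apply: contraNneq h2 => e; rewrite -(mulfK y0 1) mul1r -mulrDl e mul0r.
have g3 : y - x != 0 by apply: contraNneq h3 => e; rewrite -(mulfK y0 1) mul1r -mulrBl e mul0r.
have g4 : x - y != 0 by rewrite -opprB oppr_eq0.
by field; rewrite g1 g2 g3 g4 x0 y0.
Qed.

(** * Dominated convergence for series *)

Variable R : realType.
Local Notation C := (R[i]).

Lemma eventually_all (P : nat -> nat -> Prop) (M : nat) :
  (forall k, exists N0, forall N, (N0 <= N)%N -> P k N) ->
  exists N0, forall k N, (k < M)%N -> (N0 <= N)%N -> P k N.
Proof.
move=> h; elim: M => [|M [N0 H0]]; first by exists 0%N.
have [N1 H1] := h M; exists (maxn N0 N1) => k N; rewrite ltnS leq_eqVlt geq_max.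
by move=> /orP[/eqP->|kM] /andP[a b]; [exact: H1|exact: H0].
Qed.

(** Cut at M: the tail is small since the weights differ from 1 by at most 2 and u is absolutely
    summable; the finitely many head weights are close to 1 for large N. *)
Lemma tannery (u : nat -> C) (rho : nat -> nat -> R) (B : R) :
  (forall n, \sum_(k < n) cmod (u k) <= B) ->
  (forall N k, (k < N)%N -> `|rho N k - 1| <= 2) ->
  (forall k (e : R), 0 < e -> exists N0, forall N, (N0 <= N)%N -> `|rho N k - 1| < e) ->
  cvgC (fun N => \sum_(k < N) (rho N k)%:C%C * u k) (csum u).
Proof.
move=> hB rho2 rho1 e e0.
have B0 : 0 <= B by apply: le_trans _ (hB 0%N); rewrite big_ord0.
have B1 : 0 < B + 1 by rewrite ltr_wpDl.
have [N1 H1] := csumP hB (eps := e / 3) ltac:(by rewrite divr_gt0).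
have cn : cvgn (series (fun k => cmod (u k))).
  by apply: bounded_sum_cvg hB => k; exact: cmod_ge0.
(* Two partial sums within e / 12 of the limit differ by less than e / 6; the factor 2 on the
   weights turns this into e / 3. *)
have /cvgrPdist_lt /(_ (e / 12)) := cn.
rewrite divr_gt0 // => /(_ isT) [M _ HM].
have e3B : 0 < e / 3 / (B + 1) by rewrite !divr_gt0.
have [N2 H2] := @eventually_all (fun k N => `|rho N k - 1| < e / 3 / (B + 1)) M
  (fun k => rho1 k _ e3B).
exists (maxn (maxn N1 N2) M) => N; rewrite !geq_max => /andP[/andP[a1 a2] a3].
have -> : \sum_(k < N) (rho N k)%:C%C * u k - csum u =
   (psum u N - csum u) + \sum_(k < N) ((rho N k)%:C%C - 1) * u k.
  rewrite /psum addrAC -big_split /=; congr (_ - _); apply: eq_bigr => k _.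
  by rewrite mulrBl mul1r addrC subrK.
apply: le_lt_trans (cmodD _ _) _.
have h1 := H1 N a1.
have h2 : cmod (\sum_(k < N) ((rho N k)%:C%C - 1) * u k) <=
    \sum_(0 <= k < N) `|rho N k - 1| * cmod (u k).
  apply: le_trans (cmod_sum _ _ _) _; rewrite big_mkord; apply: ler_sum => k _.
  by rewrite cmodM -[1]/(1%:C%C) -rmorphB cmod_real.
rewrite (big_cat_nat (n := M)) //= in h2.
have h3 : \sum_(0 <= k < M) `|rho N k - 1| * cmod (u k) <= e / 3.
  apply: le_trans (_ : \sum_(0 <= k < M) e / 3 / (B + 1) * cmod (u k) <= _).
    rewrite big_nat [leRHS]big_nat; apply: ler_sum => k /andP[_ kM].
    by rewrite ler_wpM2r ?cmod_ge0 // ltW // H2.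
  rewrite -mulr_sumr big_mkord mulrAC ler_pdivrMr // ler_wpM2l ?divr_ge0 ?ltW//.
  by apply: le_lt_trans (hB M) _; rewrite ltrDl.
have h4 : \sum_(M <= k < N) `|rho N k - 1| * cmod (u k) <= 2 * \sum_(M <= k < N) cmod (u k).
  rewrite mulr_sumr big_nat [leRHS]big_nat; apply: ler_sum => k /andP[_ kN].
  by rewrite ler_wpM2r ?cmod_ge0 // rho2.
have h5 : \sum_(M <= k < N) cmod (u k) < e / 6.
  have x1 := HM M (leqnn M); have x2 := HM N a3.
  rewrite /= /series /= in x1 x2; rewrite (big_cat_nat (n := M) (p := N)) //= in x2.
  by move: x1 x2; rewrite !ltr_norml; lra.
by move: h1 h2 h3 h4 h5; lra.
Qed.

End Interpolation.

(** * Sums with simple poles *)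

Section SimplePoles.
Set Implicit Arguments. Unset Strict Implicit.
Variable R : realType.
Local Notation C := (R[i]).
Implicit Types (w : nat -> seq (C * C)) (a z : C).

Definition is_pole w a := exists k q, q \in w k /\ q.2 = a.

Definition sqrt_mass_le w (S : R) :=
  forall n, \sum_(k < n) \sum_(q <- w k) Num.sqrt (cmod q.1) <= S.

Lemma sqrt_mass w (S : R) : sqrt_mass_le w S -> mass_le w (S ^+ 2).
Proof.
move=> h n; have s0 (q : C * C) : 0 <= Num.sqrt (cmod q.1) by exact: sqrtr_ge0.
apply: le_trans (_ : (\sum_(k < n) \sum_(q <- w k) Num.sqrt (cmod q.1)) ^+ 2 <= _).
  apply: le_trans _ (sum_sqr_le _ _); last by move=> k; apply: sumr_ge0.
  apply: ler_sum => k _; apply: le_trans _ (sum_sqr_le _ s0).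
  by apply: ler_sum => q _; rewrite sqr_sqrtr // cmod_ge0.
apply: lerXn2r; last exact: h; rewrite nnegrE; last first.
  by apply: le_trans _ (h 0%N); rewrite big_ord0.
by apply: sumr_ge0 => k _; apply: sumr_ge0.
Qed.

(** Blocks with k > |a| + 1 stay at distance at least 1 from [a], and the finitely many others
    contain finitely many poles. *)
Lemma isolated w a : (forall k q, q \in w k -> k%:R <= cmod q.2) ->
  exists d : R, 0 < d /\ forall k q, q \in w k -> q.2 != a -> d <= cmod (a - q.2).
Proof.
move=> hw; have fin (l : seq (C * C)) : exists d : R, 0 < d /\
    forall q, q \in l -> q.2 != a -> d <= cmod (a - q.2).
  elim: l => [|q l [d [d0 hd]]]; first by exists 1.
  have [qa|qa] := eqVneq q.2 a.
    by exists d; split => // p; rewrite inE => /orP[/eqP->|/hd//]; rewrite qa eqxx.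
  exists (Num.min d (cmod (a - q.2))); split.
    by rewrite lt_min d0 cmod_gt0 subr_eq0 eq_sym.
  move=> p; rewrite inE ge_min => /orP[/eqP->|/hd h /h ->//].
  by rewrite lexx orbT.
have finM M : exists d : R, 0 < d /\
    forall k q, (k < M)%N -> q \in w k -> q.2 != a -> d <= cmod (a - q.2).
  elim: M => [|M [d [d0 hd]]]; first by exists 1.
  have [e [e0 he]] := fin (w M); exists (Num.min d e); rewrite lt_min d0; split => //.
  move=> k q; rewrite ltnS leq_eqVlt ge_min => /orP[/eqP->|kM] qw qa.
    by rewrite (he _ qw qa) orbT.
  by rewrite (hd _ _ kM qw qa).
have [d [d0 hd]] := finM (Num.truncn (cmod a + 1)).+1.
exists (Num.min d 1); rewrite lt_min d0 ltr01; split => // k q qw qa.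
have [kM|Mk] := ltnP k (Num.truncn (cmod a + 1)).+1.
  by rewrite ge_min (hd _ _ kM qw qa).
rewrite ge_min; apply/orP; right.
have h1 : cmod a + 1 < k%:R.
  by apply: lt_le_trans (truncnS_gt _) _; rewrite ler_nat.
by have := cmodB q.2 a; rewrite cmod_distC; have := hw _ _ qw; lra.
Qed.

(** A term with pole [z] itself is 0 by the convention [0^-1 = 0], and the other poles keep a
    positive distance; the series thus converges at its poles too. *)
Lemma cauchy_cvg_isolated w z (B : R) : mass_le w B ->
  (forall k q, q \in w k -> k%:R <= cmod q.2) ->
  cvgC (psum (cterm w z)) (cauchy w z).
Proof.
move=> hB hw; have [d [d0 hd]] := isolated z hw; apply: (@csumP _ _ (d^-1 * B)) => n.
apply: blocks_le => // [|k q qw]; first by rewrite invr_ge0 ltW.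
rewrite cmodM cmodV mulrC ler_wpM2r ?cmod_ge0//.
have [->|qz] := eqVneq q.2 z; first by rewrite subrr cmod0 invr0 invr_ge0 ltW.
have dz := hd k q qw qz.
by rewrite lef_pV2 ?posrE ?(lt_le_trans d0)// dz.
Qed.

Lemma residue_uniq (l : seq (C * C)) q0 : uniq [seq q.2 | q <- l] -> q0 \in l ->
  \sum_(q <- l | q.2 == q0.2) q.1 = q0.1.
Proof.
elim: l => // p l ih /= /andP[pl ul]; rewrite inE big_cons => /orP[/eqP->|ql].
  rewrite eqxx big_seq_cond big1 ?addr0 // => q /andP[ql /eqP e].
  by move: pl; rewrite -e map_f.
case: eqP => [e|_]; last exact: ih.
by move: pl; rewrite e map_f.
Qed.

Lemma holo_horner (P : {poly C}) z : holo_at (horner P) z.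
Proof.
elim/poly_ind: P => [|P c /(holo_at_affineM c 0) h].
  exists 0 => e e0; exists 1; split => // h _.
  by rewrite !horner0 subrr mul0r subr0 cmod0.
suff -> : horner (P * 'X + c%:P) = (fun z => c + (z - 0) * P.[z]) by [].
by apply/funext => y; rewrite hornerMXaddC subr0 addrC mulrC.
Qed.

(** Near a simple pole |f z| exceeds |h a| / (2 |z - a|), which passes any bound. *)
Lemma has_order_bounded f a (M : R) : has_order f a (-1) ->
  (exists r : R, 0 < r /\ forall z, 0 < cmod (z - a) < r -> cmod (f z) <= M) -> False.
Proof.
move=> [r [r0 [h [hh [ha fE]]]]] [r' [r0' hM]].
have [d [d0 H]] := holo_at_nonzero (hh a ltac:(by rewrite subrr cmod0)) ha.
have q0 : 0 < cmod (h a) / 2 by rewrite divr_gt0 // cmod_gt0.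
have M1 : 0 < `|M| + 1 by rewrite ltr_wpDl.
have [|z] := @exists_near R a (Num.min (Num.min r r') (Num.min d (cmod (h a) / 2 / (`|M| + 1)))).
  by rewrite !lt_min r0 r0' d0 divr_gt0.
rewrite !lt_min => /andP[z0 /andP[/andP[zr zr'] /andP[zd zq]]].
have zn : z - a != 0 by rewrite -cmod_gt0.
have := hM z; rewrite z0 zr' => /(_ isT).
rewrite fE ?z0 // exprN1 cmodM cmodV mulrC ler_pdivrMr // => b1.
have := H z zd; move: zq; rewrite ltr_pdivlMr // => b2 b3.
have : M * cmod (z - a) <= cmod (z - a) * (`|M| + 1).
  by rewrite mulrC ler_wpM2l ?cmod_ge0 // (le_trans (ler_norm M)) // lerDl.
by move: b1 b2 b3; lra.
Qed.

(** * Orders, transcendence and pole count when all poles are simple *)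

Section Fixed.
Variables (w : nat -> seq (C * C)) (S : R).
Hypothesis wS : sqrt_mass_le w S.
Hypothesis w_far : forall k q, q \in w k -> k%:R <= cmod q.2.
Hypothesis w_uniq : forall k, uniq [seq q.2 | q <- w k].
Hypothesis w_disj : forall k k' q q', q \in w k -> q' \in w k' -> q.2 = q'.2 -> k = k'.
Hypothesis w_neq0 : forall k q, q \in w k -> q.1 != 0.

Lemma pole_order a : is_pole w a -> has_order (cauchy w) a (-1).
Proof.
move=> [k0 [q0 [q0w <-]]]; have [d [d0 hd]] := isolated q0.2 w_far.
apply: cauchy_pole (sqrt_mass wS) d0 hd _ _.
  move=> k kk0 q qw; apply: contra kk0 => /eqP e.
  by apply/eqP; exact: w_disj qw q0w e.
by rewrite residue_uniq //; exact: w_neq0 q0w.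
Qed.

Lemma regular_order a : ~ is_pole w a ->
  (locally_zero (cauchy w) a /\ cauchy w a = 0) \/
  exists m : nat, has_order (cauchy w) a m /\ (m = 0%N <-> cauchy w a != 0).
Proof.
move=> np; have [d [d0 hd]] := isolated a w_far.
apply: cauchy_regular (sqrt_mass wS) d0 _ => k q qw; apply: (hd _ _ qw).
by apply/eqP => e; apply: np; exists k, q.
Qed.

Lemma cauchy_meromorphic : meromorphic (cauchy w).
Proof.
move=> a; have [/pole_order h|/regular_order[[]|[m [h _]]]] := pselect (is_pole w a).
- by right; exists (-1).
- by left.
- by right; exists m%:Z.
Qed.

Lemma pole_mult_regular a : ~ is_pole w a -> pole_mult (cauchy w) a = 0.
Proof.
rewrite /pole_mult => /regular_order[[/locally_zero_order -> _]|[m [/has_order_eq -> _]]].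
  by rewrite oppr0 maxxx.
by rewrite max_l // oppr_le0.
Qed.

Lemma pole_mult_le1 a : pole_mult (cauchy w) a <= 1.
Proof.
have [/pole_order /has_order_eq h|/pole_mult_regular ->] := pselect (is_pole w a); last exact: ler01.
by rewrite /pole_mult h.
Qed.

(** Each block supplies a pole, distinct from those of other blocks. At a pole where Q does not
    vanish, P / Q is bounded, contradicting order -1. *)
Lemma cauchy_not_rational : (forall k, w k != [::]) -> ~ Defs.rational (cauchy w).
Proof.
move=> wn [P [Q [Q0 hPQ]]].
pose p k := (head (0, 0) (w k)).2.
have pw k : head (0, 0) (w k) \in w k.
  by have := wn k; case: (w k) => //= q l _; rewrite inE eqxx.
have pinj : injective p by move=> k k' e; exact: w_disj (pw k) (pw k') e.
(* Otherwise Q would have [size Q] distinct roots, one more than its degree allows. *)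
have [k Qk] : exists k, Q.[p k] != 0.
  apply: contrapT => h; pose l := [seq p k | k <- iota 0 (size Q)].
  have : all (root Q) l.
    apply/allP => _ /mapP[k _ ->]; rewrite /root; apply/negPn/negP => e.
    by apply: h; exists k.
  move=> /(max_poly_roots Q0) /(_ _).
  by rewrite map_inj_uniq ?iota_uniq // size_map size_iota ltnn => /(_ isT).
have hord : has_order (cauchy w) (p k) (-1) by apply: pole_order; exists k, (head (0, 0) (w k)).
have [r [r0 hr]] := hPQ (p k).
have [d [d0 Hd]] := holo_at_nonzero (holo_horner Q (p k)) Qk.
have [d' [d0' Hd']] := holo_at_continuous (holo_horner P (p k)) ltr01.
apply: (@has_order_bounded _ _ ((cmod P.[p k] + 1) / (cmod Q.[p k] / 2)) hord).
exists (Num.min r (Num.min d d')); rewrite !lt_min r0 d0; split => // z.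
rewrite !lt_min => /and4P[z0 zr zd zd'].
have Qz := Hd z zd; have q0 : 0 < cmod Q.[p k] / 2 by rewrite divr_gt0 // cmod_gt0.
rewrite hr ?z0 //; last by rewrite -cmod_gt0 (lt_trans q0).
rewrite cmodM cmodV; apply: ler_pM; rewrite ?invr_ge0 ?cmod_ge0 //.
  have := Hd' z zd'; have := cmodB P.[z] P.[p k]; lra.
by rewrite lef_pV2 ?posrE ?(lt_trans q0 Qz) // ltW.
Qed.

Lemma npoles_cauchy0 t : (forall a, is_pole w a -> t < cmod a) ->
  npoles (cauchy w) t = 0.
Proof.
move=> h; apply: npoles0 => a at_; apply: pole_mult_regular => /h.
by rewrite ltNge at_.
Qed.

Lemma npoles_cauchy_le t K : (forall k q, q \in w k -> cmod q.2 <= t -> (k < K)%N) ->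
  npoles (cauchy w) t <= (\sum_(k < K) size (w k))%:R.
Proof.
move=> h; pose L := flatten [seq [seq q.2 | q <- w k] | k <- iota 0 K].
have sL : size L = (\sum_(k < K) size (w k))%N.
  rewrite size_flatten /shape -map_comp sumnE big_map -(big_mkord xpredT (fun k => size (w k))).
  by rewrite /index_iota subn0; apply: eq_bigr => k _; rewrite /= size_map.
rewrite -sL; apply: npoles_le => a; last exact: pole_mult_le1.
move=> at_; have [[k [q [qw e]]] _|/pole_mult_regular ->] := pselect (is_pole w a); last by rewrite eqxx.
apply/flattenP; exists [seq q.2 | q <- w k]; last by apply/mapP; exists q.
by apply/map_f; rewrite mem_iota /= add0n; apply: h qw _; rewrite e.
Qed.

End Fixed.
End SimplePoles.

(** * Residues for a sparse sequence *)

Section SparseCoefficients.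
Set Implicit Arguments. Unset Strict Implicit.
Variable R : realType.
Local Notation C := (R[i]).
Variable n : nat -> nat.
Hypothesis n_gt0 : (0 < n 0)%N.
Hypothesis n_sparse : forall k, (2 ^ k.+1 * n k ^ 2 <= n k.+1)%N.

(** Half the side of the k-th square. Its corners satisfy z^4 = - [quartic k], because (1 + i)^4 =
    -4. *)
Definition side k : R := (n k)%:R.
Definition quartic k : R := 4 * side k ^+ 4.

Lemma quarticE k : quartic k = 4 * side k ^+ 4.
Proof. by []. Qed.

Lemma n_double k : (0 < n k)%N /\ (2 * n k <= n k.+1)%N.
Proof.
have dbl j : (0 < n j)%N -> (2 * n j <= n j.+1)%N.
  move=> j0; apply: leq_trans (n_sparse j); rewrite expnS expnS -!mulnA leq_mul2l /=.
  by rewrite -{1}[n j]mul1n leq_mul ?expn_gt0 // expn1 leq_pmulr.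
suff h : (0 < n k)%N by split=> //; exact: dbl.
elim: k => // k ih; apply: leq_trans (dbl _ ih); by rewrite muln_gt0.
Qed.

Lemma n_ge k : (k < n k)%N.
Proof.
elim: k => // k ih; have [_] := n_double k; apply: leq_trans.
by rewrite mul2n -addnn -(addn1 k.+1) leq_add // (leq_trans _ ih).
Qed.

Lemma n_lt : {homo n : i j / (i < j)%N}.
Proof.
apply: homo_ltn => // [y x z|k]; first exact: ltn_trans.
by have [h] := n_double k; apply: leq_trans; rewrite mul2n -addnn -addn1 leq_add.
Qed.

Lemma n_inj : injective n.
Proof.
move=> i j e; apply/eqP; rewrite eqn_leq; apply/andP.
by split; rewrite leqNgt; apply/negP => /n_lt; rewrite e ltnn.
Qed.

Lemma side_ge1 k : 1 <= side k.
Proof. by rewrite ler1n; have [] := n_double k. Qed.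

Lemma side_gt0 k : 0 < side k.
Proof. exact: lt_le_trans ltr01 (side_ge1 k). Qed.

Lemma side_ge k : k%:R <= side k.
Proof. by rewrite ler_nat ltnW // n_ge. Qed.

Lemma quartic_gt0 k : 0 < quartic k.
Proof. by rewrite mulr_gt0 // exprn_gt0 // side_gt0. Qed.

Lemma quartic_ratio k i : quartic k * 4 ^+ i <= quartic (k + i).
Proof.
elim: i => [|i ih]; first by rewrite expr0 mulr1 addn0.
rewrite addnS; have h : 2 * side (k + i) <= side (k + i).+1.
  by rewrite -natrM ler_nat; have [] := n_double (k + i).
have h4 : (2 * side (k + i)) ^+ 4 <= side (k + i).+1 ^+ 4.
  by apply: lerXn2r => //; rewrite nnegrE ?mulr_ge0 // ltW // side_gt0.
have q0 := quartic_gt0 (k + i).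
rewrite exprS mulrCA; apply: le_trans (_ : 4 * quartic (k + i) <= _).
  by rewrite ler_wpM2l.
by rewrite /quartic; rewrite exprMn in h4; move: q0 h4; rewrite /quartic; lra.
Qed.

Lemma quartic_inj : injective quartic.
Proof.
move=> i j; wlog ij : i j / (i <= j)%N => [h e|e].
  by case/orP: (leq_total i j) => /h; [apply|move=> H; apply/esym/H].
apply/eqP; rewrite eqn_leq ij leqNgt; apply/negP => lt.
have := quartic_ratio i (j - i); rewrite subnKC // -e.
have : (4 : R) <= 4 ^+ (j - i).
  by rewrite -{1}[4]expr1 ler_weXn2l ?subn_gt0 // ler1n.
by have := quartic_gt0 i => q0 h; rewrite leNgt; apply/negP/negPn; nra.
Qed.

(** The product over j != k that occurs in the partial fractions is cut at k: below k its factors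
    are large, above k they are close to 1 and form a convergent product. *)
Definition lower_prod k : R := \prod_(j < k) (1 - quartic k / quartic j).
Definition upper_prod k m : R := \prod_(i < m) (1 - quartic k / quartic (k.+1 + i)).

Lemma upper_factor k i : 0 <= quartic k / quartic (k.+1 + i) <= 4^-1 ^+ i.+1.
Proof.
rewrite divr_ge0 ?(ltW (quartic_gt0 _)) //=.
rewrite ler_pdivrMr ?quartic_gt0 // exprVn mulrC ler_pdivlMr ?exprn_gt0 //.
by rewrite addSnnS; exact: quartic_ratio.
Qed.

Lemma expV4_le1 i : (4^-1 : R) ^+ i <= 1.
Proof. by rewrite exprn_ile1 // invf_le1 // ler1n. Qed.

Lemma upper_prod_bounds k m : 2^-1 <= upper_prod k m <= 1.
Proof.
(* The bound 1/2 alone is not inductive. With e = 4^-m the step is (1/2 + e/2)(1 - e/4) >= 1/2 +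
   e/8. *)
have h : 2^-1 + 2^-1 * 4^-1 ^+ m <= upper_prod k m <= 1.
  elim: m => [|m /andP[ih1 ih2]]; first by rewrite /upper_prod big_ord0 expr0; lra.
  rewrite /upper_prod big_ord_recr /= -/(upper_prod k m).
  have /andP[] := upper_factor k m; have := expV4_le1 m.
  have e0 : 0 <= (4^-1 : R) ^+ m by rewrite exprn_ge0.
  rewrite exprS; move: ih1 ih2 e0; move: (upper_prod k m) (4^-1 ^+ m) (quartic k / _).
  move=> q e x h1 h2 e0 e1 x0 xe; have x1 : x <= 4^-1 * e by lra.
  have h3 : 0 <= 1 - x by lra.
  apply/andP; split; last by nra.
  apply: le_trans (_ : (2^-1 + 2^-1 * e) * (1 - 4^-1 * e) <= _); first by nra.
  by apply: ler_pM => //; lra.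
move: h; have : 0 <= (4^-1 : R) ^+ m by rewrite exprn_ge0.
by move=> a /andP[b ->]; rewrite andbT; lra.
Qed.

Lemma upper_prod_cvg k : exists l, 2^-1 <= l <= 1 /\
  forall e : R, 0 < e -> exists m0, forall m, (m0 <= m)%N -> `|upper_prod k m - l| < e.
Proof.
have dec : nonincreasing_seq (upper_prod k).
  apply/nonincreasing_seqP => m; rewrite /upper_prod big_ord_recr /= -/(upper_prod k m).
  have /andP[x0 _] := upper_factor k m; have /andP[q0 _] := upper_prod_bounds k m.
  by nra.
have cv : cvgn (upper_prod k).
  apply: nonincreasing_is_cvgn => //; exists 2^-1 => _ [m _ <-].
  by have /andP[] := upper_prod_bounds k m.
have /cvgrPdist_lt h := cv.
exists (limn (upper_prod k)); split.
  apply/andP; split.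
    by apply: limr_ge => //; apply: nearW => m; have /andP[] := upper_prod_bounds k m.
  by apply: limr_le => //; apply: nearW => m; have /andP[] := upper_prod_bounds k m.
by move=> e /h [m0 _ H]; exists m0 => m /H; rewrite distrC.
Qed.

Definition upper_lim k : R := xget 0 [set l | 2^-1 <= l <= 1 /\
  forall e : R, 0 < e -> exists m0, forall m, (m0 <= m)%N -> `|upper_prod k m - l| < e].

Lemma upper_limP k : 2^-1 <= upper_lim k <= 1 /\
  forall e : R, 0 < e -> exists m0, forall m, (m0 <= m)%N -> `|upper_prod k m - upper_lim k| < e.
Proof. exact: xgetPex (upper_prod_cvg k). Qed.

Lemma lower_prod_factor k j : (j < k)%N -> 1 <= `|1 - quartic k / quartic j|.
Proof.
move=> jk; have h : 4 <= quartic k / quartic j.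
  rewrite ler_pdivlMr ?quartic_gt0 //; have := quartic_ratio j (k - j).
  rewrite subnKC ?(ltnW jk) //; apply: le_trans; rewrite mulrC.
  rewrite ler_wpM2l ?(ltW (quartic_gt0 _)) //.
  by rewrite -{1}[4]expr1 ler_weXn2l ?subn_gt0 // ler1n.
by rewrite ler0_norm; lra.
Qed.

Lemma lower_prod_ge1 k : 1 <= `|lower_prod k|.
Proof.
rewrite /lower_prod normr_prod; have h j : (j < k)%N -> 1 <= `|1 - quartic k / quartic j|.
  exact: lower_prod_factor.
elim/big_ind: _ => // [x y x1 y1|j _]; last exact: h.
by rewrite -[1]mulr1; apply: ler_pM.
Qed.

(** The last two factors are each at least half the ratio, the others at least 1. One factor would
    not suffice: for x = [side k.+1] and y = [side k.+2], the estimate of [sqrt_coef_le] would then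
    only be of order x^2. *)
Lemma lower_prod_growth k :
  (quartic k.+2 / quartic k.+1 / 2) ^+ 2 <= `|lower_prod k.+2|.
Proof.
rewrite /lower_prod big_ord_recr big_ord_recr /= normrM normrM.
have q1 := quartic_gt0 k; have q2 := quartic_gt0 k.+1; have q3 := quartic_gt0 k.+2.
have r1 := quartic_ratio k 1; rewrite addn1 expr1 in r1.
have r2 := quartic_ratio k.+1 1; rewrite addn1 expr1 in r2.
set P := \prod_(_ < _) _; have P1 : 1 <= `|P|.
  rewrite /P normr_prod; elim/big_ind: _ => // [x y x1 y1|j _].
    by rewrite -[1]mulr1; apply: ler_pM.
  by apply: lower_prod_factor; rewrite /= (ltn_trans (ltn_ord j)).
set x := quartic k.+2 / quartic k.+1; set y := quartic k.+2 / quartic k.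
have x4 : 4 <= x by rewrite /x ler_pdivlMr // mulrC.
have xy : x <= y.
  by rewrite /x /y ler_wpM2l ?(ltW q3)// lef_pV2 ?posrE //; lra.
have h1 : x / 2 <= `|1 - x| by rewrite ler0_norm; lra.
have h2 : x / 2 <= `|1 - y| by rewrite ler0_norm; lra.
rewrite -mulrA expr2 -[leLHS]mul1r; apply: ler_pM => //; first by rewrite mulr_ge0 //; lra.
by apply: ler_pM => //; lra.
Qed.

(** The partial fraction coefficient of the infinite product; [rho N k] is the ratio of the
    coefficient for the first N factors to this limit. *)
Definition coef k : R := (lower_prod k)^-1 * (upper_lim k)^-1.
Definition rho N k : R := upper_lim k / upper_prod k (N - k.+1).

Lemma lower_prod_neq0 k : lower_prod k != 0.
Proof. by rewrite -normr_gt0; exact: lt_le_trans ltr01 (lower_prod_ge1 k). Qed.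

Lemma upper_lim_gt0 k : 0 < upper_lim k.
Proof. have [/andP[h _] _] := upper_limP k; lra. Qed.

Lemma upper_prod_gt0 k m : 0 < upper_prod k m.
Proof. have /andP[h _] := upper_prod_bounds k m; lra. Qed.

Lemma coef_neq0 k : coef k != 0.
Proof. by rewrite mulf_neq0 ?invr_eq0 ?lower_prod_neq0// gt_eqF // upper_lim_gt0. Qed.

Lemma coef_le k : `|coef k| <= 2 / `|lower_prod k|.
Proof.
have [/andP[h _] _] := upper_limP k; have u0 := upper_lim_gt0 k.
rewrite /coef normrM !normfV mulrC ler_wpM2r ?invr_ge0 //.
by rewrite gtr0_norm // invf_ple ?posrE.
Qed.

Lemma rho_bound N k : `|rho N k - 1| <= 2.
Proof.
have [/andP[h1 h2] _] := upper_limP k; have /andP[h3 h4] := upper_prod_bounds k (N - k.+1).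
have u0 := upper_prod_gt0 k (N - k.+1).
have : 0 <= rho N k <= 2.
  by rewrite /rho divr_ge0 ?(ltW (upper_lim_gt0 _)) ?(ltW u0) //= ler_pdivrMr //; lra.
by rewrite ler_norml; lra.
Qed.

Lemma rho_cvg k (e : R) : 0 < e -> exists N0, forall N, (N0 <= N)%N -> `|rho N k - 1| < e.
Proof.
(* The tolerance e / 2 compensates for division by [upper_prod], which is at least 1/2. *)
move=> e0; have [_ h] := upper_limP k; have [m0 H] := h (e / 2) ltac:(by rewrite divr_gt0).
exists (k.+1 + m0)%N => N hN; have := H (N - k.+1)%N ltac:(by rewrite leq_subRL // (leq_trans (leq_addr _ _) hN)).
have /andP[h3 h4] := upper_prod_bounds k (N - k.+1).
have u0 := upper_prod_gt0 k (N - k.+1).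
rewrite /rho; move: h3 h4 u0; move: (upper_prod _ _) (upper_lim k) => x l h3 h4 x0.
rewrite distrC => hx; have -> : l / x - 1 = (l - x) / x by field; rewrite gt_eqF.
rewrite normrM normfV (gtr0_norm x0) ltr_pdivrMr //.
by apply: lt_le_trans hx _; nra.
Qed.

Lemma prod_skip (F : nat -> R) k m :
  \prod_(j < k.+1 + m | j != k :> nat) F j = (\prod_(j < k) F j) * \prod_(i < m) F (k.+1 + i)%N.
Proof.
elim: m => [|m ih].
  rewrite big_ord0 mulr1 addn0 big_mkcond big_ord_recr /= eqxx mulr1.
  by apply: eq_bigr => j _; rewrite ltn_eqF.
rewrite addnS big_mkcond big_ord_recr /= -big_mkcond ih gtn_eqF ?ltnS ?leq_addr //=.
by rewrite big_ord_recr mulrA.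
Qed.

Lemma finite_coef N k : (k < N)%N ->
  \prod_(j < N | j != k :> nat) (1 - quartic k / quartic j)^-1 = coef k * rho N k.
Proof.
move=> kN; have := prod_skip (fun j => (1 - quartic k / quartic j)^-1) k (N - k.+1).
rewrite subnKC // => ->; rewrite !prodfV -/(lower_prod k).
rewrite -/(upper_prod k (N - k.+1)) /coef /rho.
by rewrite -mulrA mulKf // gt_eqF // upper_lim_gt0.
Qed.

Lemma geometric_le (m : nat) : \sum_(k < m) (2^-1 : R) ^+ k <= 2.
Proof.
have -> : \sum_(k < m) (2^-1 : R) ^+ k = 2 - 2 * 2^-1 ^+ m.
  elim: m => [|m ih]; first by rewrite big_ord0 expr0; lra.
  by rewrite big_ord_recr /= ih exprS; lra.
have : 0 <= (2^-1 : R) ^+ m by rewrite exprn_ge0.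
lra.
Qed.

(** With x = [side k.+1] and y = [side k.+2], the 4 y poles of two strings have square-root residues
    at most 2 x^4 / y^3. The total is at most 8 (x^2 / y)^2, and sparsity gives x^2 / y <=
    2^-(k+2). *)
Lemma sqrt_coef_le k :
  4 * side k.+2 * Num.sqrt (`|coef k.+2| * side k.+2 ^+ 2 / 2) <= 8 * 2^-1 ^+ k.
Proof.
pose x := side k.+1; pose y := side k.+2.
have x1 : 1 <= x := side_ge1 _; have y1 : 1 <= y := side_ge1 _.
have xy : 2 ^+ k.+2 * x ^+ 2 <= y by rewrite -natrX -natrX -natrM ler_nat; exact: n_sparse.
have x0 : 0 < x by lra. have y0 : 0 < y by lra.
have b : Num.sqrt (`|coef k.+2| * y ^+ 2 / 2) <= 2 * x ^+ 4 / y ^+ 3.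
  have p0 : 0 <= 2 * x ^+ 4 / y ^+ 3 by rewrite divr_ge0 // ?mulr_ge0 ?exprn_ge0 // ltW.
  rewrite -[leRHS]ger0_norm // -[leRHS]sqrtr_sqr ler_wsqrtr //.
  have g := lower_prod_growth k; have c := coef_le k.+2.
  have l0 : 0 < `|lower_prod k.+2| := lt_le_trans ltr01 (lower_prod_ge1 _).
  have gE : quartic k.+2 / quartic k.+1 / 2 = y ^+ 4 / x ^+ 4 / 2.
    by rewrite /quartic -/x -/y; field; rewrite gt_eqF.
  rewrite gE in g; have g0 : 0 < (y ^+ 4 / x ^+ 4 / 2) ^+ 2.
    by rewrite exprn_gt0 // !divr_gt0 ?exprn_gt0.
  have c' : `|coef k.+2| <= 2 / (y ^+ 4 / x ^+ 4 / 2) ^+ 2.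
    by apply: le_trans c _; rewrite ler_wpM2l // lef_pV2 ?posrE.
  apply: le_trans (_ : 2 / (y ^+ 4 / x ^+ 4 / 2) ^+ 2 * (y ^+ 2 / 2) <= _).
    by rewrite -mulrA ler_wpM2r // divr_ge0 // exprn_ge0 // ltW.
  by rewrite le_eqVlt; apply/orP; left; apply/eqP; field; rewrite !gt_eqF.
apply: le_trans (_ : 4 * y * (2 * x ^+ 4 / y ^+ 3) <= _).
  by rewrite ler_wpM2l // mulr_ge0 // ltW.
have -> : 4 * y * (2 * x ^+ 4 / y ^+ 3) = 8 * (x ^+ 2 / y) ^+ 2.
  by field; rewrite gt_eqF.
rewrite ler_wpM2l //.
have h : x ^+ 2 / y <= 2^-1 ^+ k.+2.
  by rewrite ler_pdivrMr // exprVn mulrC ler_pdivlMr ?exprn_gt0 // mulrC.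
have h0 : 0 <= x ^+ 2 / y by rewrite divr_ge0 ?exprn_ge0 // ltW.
have e0 : 0 <= (2^-1 : R) ^+ k by rewrite exprn_ge0.
have e1 : (2^-1 : R) ^+ k <= 1 by rewrite exprn_ile1 // invf_le1 // ler1n.
by rewrite (exprS _ k.+1) (exprS _ k) in h; move: h h0 e0 e1; move: (_ ^+ k) (x ^+ 2 / y) => e t; nra.
Qed.

Lemma sqrt_coef_sum : exists S : R, forall m,
  \sum_(k < m) 4 * side k * Num.sqrt (`|coef k| * side k ^+ 2 / 2) <= S.
Proof.
pose t k := 4 * side k * Num.sqrt (`|coef k| * side k ^+ 2 / 2).
have t0 k : 0 <= t k by rewrite !mulr_ge0 ?sqrtr_ge0 // ltW // side_gt0.
have b m : \sum_(k < m) t k.+2 <= 16.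
  apply: le_trans (_ : \sum_(k < m) 8 * 2^-1 ^+ k <= _).
    by apply: ler_sum => k _; exact: sqrt_coef_le.
  by rewrite -mulr_sumr; have := geometric_le m; lra.
(* The geometric decay starts at index 2, so the first two terms enter as they are. *)
exists (t 0%N + t 1%N + 16) => -[|[|m]].
- by rewrite big_ord0 addr_ge0 // addr_ge0.
- by rewrite big_ord_recl big_ord0 /= -/(t 0%N); have := t0 1%N; lra.
- by rewrite !big_ord_recl /= -/(t 0%N) -/(t 1%N) addrA lerD2l; exact: b.
Qed.

(** Combines 1 + x <= exp x with 1 / [quartic k] <= 2^-k. Being uniform in m, it later keeps |g|
    away from 0. *)
Lemma prod_quartic_le (v : R) m : 0 <= v ->
  \prod_(k < m) (1 + v / quartic k) <= expR (2 * v).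
Proof.
move=> v0; apply: le_trans (_ : expR (\sum_(k < m) v / quartic k) <= _).
  rewrite expR_sum; apply: ler_prod => k _.
  by rewrite addr_ge0 ?divr_ge0 ?(ltW (quartic_gt0 _)) //= expR_ge1Dx.
rewrite ler_expR; apply: le_trans (_ : v * \sum_(k < m) 2^-1 ^+ k <= _).
  rewrite mulr_sumr; apply: ler_sum => k _; rewrite ler_wpM2l //.
  rewrite exprVn lef_pV2 ?posrE ?quartic_gt0 ?exprn_gt0 //.
  have := quartic_ratio 0 k; rewrite add0n; apply: le_trans.
  have q1 : 1 <= quartic 0 by have := exprn_ege1 4 (side_ge1 0); rewrite /quartic; lra.
  rewrite -[leLHS]mul1r; apply: ler_pM => //.
  by apply: lerXn2r; rewrite ?nnegrE ?ler_nat.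
by rewrite mulrC ler_wpM2r // geometric_le.
Qed.

End SparseCoefficients.

(** * The strings of poles *)

Section Construction.
Set Implicit Arguments. Unset Strict Implicit.
Variable R : realType.
Local Notation C := (R[i]).
Variable n : nat -> nat.
Hypothesis n_gt0 : (0 < n 0)%N.
Hypothesis n_sparse : forall k, (2 ^ k.+1 * n k ^ 2 <= n k.+1)%N.
Local Notation side := (side R n).
Local Notation quartic := (quartic R n).
Local Notation coef := (coef R n).

Definition corner_r k : C := Complex (side k) (side k).
Definition corner_l k : C := Complex (- side k) (side k).
(** The residue of coef z / (1 + z^4 / (4 n^4)) at a corner z is coef n^4 / z^2. At [corner_r] z^2 =
    2 i n^2; at [corner_l] z^2 has the opposite sign. *)
Definition residue k : C := Complex 0 (- (coef k * side k ^+ 2 / 2)).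

Definition corner_data k : seq (C * C) :=
  [:: (residue k, corner_r k); (- residue k, corner_l k);
      (residue k, - corner_r k); (- residue k, - corner_l k)].

(** Replacing z by z + 1 moves poles one unit to the left, so each string omits the left corner and
    ends at the right one. *)
Definition string_data k : seq (C * C) :=
  [seq (- residue k, corner_l k + j.+1%:R) | j <- iota 0 (2 * n k)] ++
  [seq (residue k, - corner_r k + j.+1%:R) | j <- iota 0 (2 * n k)].

Lemma Im_natr m : complex.Im (m%:R : C) = 0.
Proof. by rewrite raddfMn /= mul0rn. Qed.

Lemma Re_natr m : complex.Re (m%:R : C) = m%:R.
Proof. by rewrite raddfMn /=. Qed.

Lemma natrC m : (m%:R : C) = Complex m%:R 0.
Proof. by apply/eqP; rewrite eq_complex Re_natr Im_natr /= !eqxx. Qed.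

Lemma corner_Im k q : q \in corner_data k -> `|complex.Im q.2| = side k.
Proof.
have s0 := side_gt0 R n_gt0 n_sparse k.
by rewrite !inE => /or4P[] /eqP -> /=; rewrite ?normrN gtr0_norm.
Qed.

Lemma string_Im k q : q \in string_data k -> `|complex.Im q.2| = side k.
Proof.
have s0 := side_gt0 R n_gt0 n_sparse k.
by rewrite mem_cat => /orP[] /mapP[j _ ->]; rewrite raddfD /= Im_natr addr0 ?normrN gtr0_norm.
Qed.

Lemma residue_neq0 k : residue k != 0.
Proof.
have s0 := side_gt0 R n_gt0 n_sparse k; have c0 := coef_neq0 R n_gt0 n_sparse k.
rewrite eq_complex /= eqxx /= oppr_eq0 mulf_neq0 ?invr_eq0 // mulf_neq0 //.
by rewrite expf_neq0 // gt_eqF.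
Qed.

Lemma cmod_residue k : cmod (residue k) = `|coef k| * side k ^+ 2 / 2.
Proof.
rewrite /cmod /= expr0n add0r sqrrN sqrtr_sqr (normrM _ 2^-1) (normrM (coef k)) normfV.
by rewrite normrX (gtr0_norm (side_gt0 R n_gt0 n_sparse k)) (ger0_norm (ler0n _ 2)).
Qed.

Lemma corner_neq0 k q : q \in corner_data k -> q.1 != 0.
Proof. by rewrite !inE => /or4P[] /eqP -> /=; rewrite ?oppr_eq0 residue_neq0. Qed.

Lemma string_neq0 k q : q \in string_data k -> q.1 != 0.
Proof.
by rewrite mem_cat => /orP[] /mapP[j _ ->] /=; rewrite ?oppr_eq0 residue_neq0.
Qed.

(** * Blocks kept apart by the imaginary parts of their poles *)

Section Separated.
Variable w : nat -> seq (C * C).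
Hypothesis w_Im : forall k q, q \in w k -> `|complex.Im q.2| = side k.

Lemma side_le_pole k q : q \in w k -> side k <= cmod q.2.
Proof. by move=> /w_Im <-; exact: Im_le_cmod. Qed.

Lemma pole_far k q : q \in w k -> k%:R <= cmod q.2.
Proof. by move=> /side_le_pole; apply: le_trans; exact: side_ge. Qed.

Lemma pole_disj k k' q q' : q \in w k -> q' \in w k' -> q.2 = q'.2 -> k = k'.
Proof.
move=> /w_Im h /w_Im h' e; apply: (n_inj n_gt0 n_sparse); apply/eqP.
by rewrite -(eqr_nat R) -/(side k) -/(side k') -h -h' e.
Qed.

End Separated.

Lemma natrC_inj (i j : nat) : (i%:R : C) = j%:R -> i = j.
Proof. by move=> /(congr1 (@complex.Re R)); rewrite !Re_natr => /eqP; rewrite eqr_nat => /eqP. Qed.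

Lemma corner_uniq k : uniq [seq q.2 | q <- corner_data k].
Proof.
have s0 := side_gt0 R n_gt0 n_sparse k.
by rewrite /= !inE !eq_complex /= !negb_or !negb_and !andbT -!eqr_oppLR; apply/and3P; split;
  rewrite ?opprK; do ?[apply/andP; split]; apply/orP;
  (left; apply/eqP; lra) || (right; apply/eqP; lra).
Qed.

Lemma string_uniq k : uniq [seq q.2 | q <- string_data k].
Proof.
have s0 := side_gt0 R n_gt0 n_sparse k.
rewrite map_cat -!map_comp cat_uniq !map_inj_uniq ?iota_uniq ?andbT /=; last 2 first.
- by move=> i j /= /addrI /natrC_inj [].
- by move=> i j /= /addrI /natrC_inj [].
apply/hasPn => _ /mapP[j _ ->]; apply/mapP => -[i _ /= /(congr1 (@complex.Im R))].
by rewrite !raddfD /= !Im_natr; lra.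
Qed.

Lemma corner_sqrt_mass : exists S : R, sqrt_mass_le corner_data S.
Proof.
have [S hS] := sqrt_coef_sum R n_gt0 n_sparse; exists S => m; apply: le_trans (hS m).
apply: ler_sum => k _; rewrite /corner_data !big_cons big_nil /= !cmodN cmod_residue.
set x := Num.sqrt _; have x0 : 0 <= x := sqrtr_ge0 _.
by have := side_ge1 R n_gt0 n_sparse k; nra.
Qed.

Lemma string_sqrt_mass : exists S : R, sqrt_mass_le string_data S.
Proof.
have [S hS] := sqrt_coef_sum R n_gt0 n_sparse; exists S => m; apply: le_trans (hS m).
apply: ler_sum => k _; rewrite /string_data big_cat !big_map /= !cmodN cmod_residue.
have e (x : R) : \sum_(j <- iota 0 (2 * n k)) x = 2 * side k * x.
  by rewrite big_const_seq count_predT size_iota iter_addr addr0 -natrM mulr_natl.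
by rewrite !e; move: (Num.sqrt _) => x; lra.
Qed.

(** * Telescoping of the strings *)

Lemma telescope_string (c p : C) m z :
  \sum_(j <- iota 0 m) (c / (z + 1 - (p + j.+1%:R)) - c / (z - (p + j.+1%:R))) =
  c / (z - p) - c / (z - (p + m%:R)).
Proof.
have := @telescope_sumr _ 0 m (fun j : nat => - (c / (z - (p + j%:R)))) (leq0n m).
rewrite addr0 opprK addrC /index_iota subn0 => <-.
apply: eq_bigr => j _; rewrite opprK addrC; congr (_ + _ / _).
by rewrite -natr1; ring.
Qed.

Lemma string_difference k z :
  cterm string_data (z + 1) k - cterm string_data z k = cterm corner_data z k.
Proof.
rewrite /cterm /string_data /corner_data !big_cat !big_map /= opprD addrACA -!sumrB.
rewrite !telescope_string !big_cons big_nil /= !mulNr !opprK.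
have -> : corner_l k + (2 * n k)%:R = corner_r k.
  apply/eqP; rewrite natrC natrM -/(side k) eq_complex /=.
  by apply/andP; split; apply/eqP; ring.
have -> : - corner_r k + (2 * n k)%:R = - corner_l k.
  apply/eqP; rewrite natrC natrM -/(side k) eq_complex /=.
  by apply/andP; split; apply/eqP; ring.
by rewrite !opprK; ring.
Qed.

(** Within each block the inner terms cancel as identical expressions, and all three series converge
    at every z; so the equation holds at the poles as well. *)
Lemma string_cauchy_difference z :
  cauchy string_data (z + 1) - cauchy string_data z = cauchy corner_data z.
Proof.
have [S /sqrt_mass hS] := string_sqrt_mass.
have h y := cauchy_cvg_isolated y hS (pole_far string_Im).
symmetry; apply: csum_def; apply: cvgC_ext (cvgCB (h (z + 1)) (h z)) => m.
by rewrite /psum -sumrB; apply: eq_bigr => k _; exact: string_difference.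
Qed.

(** Opposite corners combine to 2 z c / (z^2 - v) and 2 z c / (z^2 + v), whose difference is 4 z c v
    / (z^4 + 4 s^4). An arbitrary field keeps this algebra apart from real and imaginary
    coordinates. *)
Lemma block_identity (F : fieldType) (z a b c d s v : F) :
  b ^+ 2 = v -> a ^+ 2 = - v -> v ^+ 2 = - (4 * s ^+ 4) -> c * v = d * s ^+ 4 ->
  4 * s ^+ 4 != 0 -> z - b != 0 -> z + b != 0 -> z - a != 0 -> z + a != 0 ->
  1 + z ^+ 4 / (4 * s ^+ 4) != 0 /\
  c / (z - b) + (- c / (z - a) + (c / (z + b) + - c / (z + a))) =
  d * (z * (1 + z ^+ 4 / (4 * s ^+ 4))^-1).
Proof.
move=> hb ha hv hc s0 n1 n2 n3 n4.
have d1 : z ^+ 2 - v != 0 by rewrite -hb subr_sqr mulf_neq0.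
have d2 : z ^+ 2 + v != 0 by rewrite -[v]opprK -ha subr_sqr mulf_neq0.
have E : z ^+ 4 + 4 * s ^+ 4 = (z ^+ 2 - v) * (z ^+ 2 + v).
  by rewrite -subr_sqr hv opprK -exprM.
have E0 : z ^+ 4 + 4 * s ^+ 4 != 0 by rewrite E mulf_neq0.
have E1 : 1 + z ^+ 4 / (4 * s ^+ 4) = (z ^+ 4 + 4 * s ^+ 4) / (4 * s ^+ 4).
  by rewrite [RHS]mulrDl divff // addrC.
split; first by rewrite E1 mulf_neq0 // invr_eq0.
rewrite E1 invf_div E.
have e1 : c / (z - b) + c / (z + b) = 2 * z * c / (z ^+ 2 - v).
  by rewrite -hb subr_sqr; field; rewrite n1 n2.
have e2 : c / (z - a) + c / (z + a) = 2 * z * c / (z ^+ 2 + v).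
  by rewrite -[v]opprK -ha subr_sqr; field; rewrite n3 n4.
have -> : c / (z - b) + (- c / (z - a) + (c / (z + b) + - c / (z + a))) =
   (c / (z - b) + c / (z + b)) - (c / (z - a) + c / (z + a)) by rewrite !mulNr; ring.
rewrite e1 e2.
have -> : d * (z * (4 * s ^+ 4 / ((z ^+ 2 - v) * (z ^+ 2 + v)))) =
   4 * z * (c * v) / ((z ^+ 2 - v) * (z ^+ 2 + v)) by rewrite hc; ring.
by field; rewrite d1 d2.
Qed.

(** * Value of a block of corners, and zeros of the corner sum *)

Lemma natC4 : (4 : C) = (4 : R)%:C%C.
Proof. by rewrite rmorphMn. Qed.

Lemma corner_term k z : ~ is_pole corner_data z ->
  1 + z ^+ 4 / (quartic k)%:C%C != 0 /\
  cterm corner_data z k = (coef k)%:C%C * (z * (1 + z ^+ 4 / (quartic k)%:C%C)^-1).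
Proof.
move=> np; have s0 := side_gt0 R n_gt0 n_sparse k.
have qE : (quartic k)%:C%C = 4 * (side k)%:C%C ^+ 4 :> C.
  by rewrite quarticE rmorphM rmorphXn /= natC4.
have qn : 4 * (side k)%:C%C ^+ 4 != 0 :> C.
  rewrite -qE -cmod_eq0 cmod_real normr_eq0 gt_eqF //.
  exact: (quartic_gt0 R n_gt0 n_sparse).
have nz c p : (c, p) \in corner_data k -> z - p != 0.
  move=> h; rewrite subr_eq0; apply/eqP => e; apply: np.
  by exists k, (c, p); rewrite e.
rewrite qE /cterm /corner_data !big_cons big_nil /= addr0 !opprK.
apply: (@block_identity _ z (corner_l k) (corner_r k) (residue k) _ _ (Complex 0 (2 * side k ^+ 2))).
- by apply/eqP; rewrite !expr2 eq_complex /=; apply/andP; split; apply/eqP; ring.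
- by apply/eqP; rewrite !expr2 eq_complex /=; apply/andP; split; apply/eqP; ring.
- rewrite natC4 -rmorphXn -rmorphM /=.
  by apply/eqP; rewrite [Complex _ _ ^+ 2]expr2 eq_complex /=; apply/andP; split; apply/eqP; ring.
- rewrite -rmorphXn -rmorphM /=.
  by apply/eqP; rewrite eq_complex /=; apply/andP; split; apply/eqP; field.
- exact: qn.
- by apply: (nz (residue k)); rewrite !inE eqxx.
- by rewrite -[corner_r k]opprK; apply: (nz (residue k)); rewrite !inE eqxx !orbT.
- by apply: (nz (- residue k)); rewrite !inE eqxx !orbT.
- by rewrite -[corner_l k]opprK; apply: (nz (- residue k)); rewrite !inE eqxx !orbT.
Qed.

(** The sums weighted by [rho] converge to [cauchy corner_data z] by [tannery], and each equals z
    over a finite product. That product is at most exp(2 |z|^4) in modulus, so the limit has modulus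
    at least |z| exp(-2 |z|^4). *)
Lemma corner_cauchy_neq0 z : ~ is_pole corner_data z -> z != 0 ->
  cauchy corner_data z != 0.
Proof.
move=> np z0; have [S /sqrt_mass hB] := corner_sqrt_mass.
have [d [d0 hd]] := isolated z (pole_far corner_Im).
have hav : avoids corner_data z d.
  by move=> k q qw; apply: (hd k q qw); apply/eqP => e; apply: np; exists k, q.
have bnd : forall m, \sum_(k < m) cmod (cterm corner_data z k) <= d^-1 * S ^+ 2.
  by apply: blocks_le => // [|k q]; [rewrite invr_ge0 ltW|exact: cterm_bound].
have cv := tannery bnd (fun N k _ => rho_bound R n_gt0 n_sparse N k)
  (fun k e e0 => rho_cvg n_gt0 n_sparse k e0).
pose v := cmod (z ^+ 4); have v0 : 0 <= v := cmod_ge0 _.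
have lb : 0 < cmod z * (expR (2 * v))^-1 by rewrite mulr_gt0 ?invr_gt0 ?expR_gt0 // cmod_gt0.
rewrite -cmod_gt0; apply: lt_le_trans lb _.
(* The index N + 1 is there because the partial fraction formula is stated for nonempty products. *)
apply: (@cvgC_ge _ (fun N => \sum_(k < N.+1) (rho R n N.+1 k)%:C%C * cterm corner_data z k)).
  by move=> e /cv[N HN]; exists N => m /leqW /HN.
move=> N; pose a i : C := (quartic i)%:C%C.
have q0 i : 0 < quartic i := quartic_gt0 R n_gt0 n_sparse i.
have a0 i : a i != 0 by rewrite -cmod_eq0 cmod_real normr_eq0 gt_eqF.
have ai : injective a.
  by move=> i j /complexI /(quartic_inj n_gt0 n_sparse).
have h i : (i < N.+1)%N -> 1 + z ^+ 4 / a i != 0 by have [] := corner_term i np.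
have -> : \sum_(k < N.+1) (rho R n N.+1 k)%:C%C * cterm corner_data z k =
   z * \prod_(j < N.+1) (1 + z ^+ 4 / a j)^-1.
  rewrite inv_prod_partial_fractions // mulr_sumr; apply: eq_bigr => k _.
  have [_ ->] := corner_term k np.
  have -> : \prod_(j < N.+1 | j != k :> nat) (1 - a k / a j)^-1 = (coef k * rho R n N.+1 k)%:C%C.
    rewrite -finite_coef // rmorph_prod; apply: eq_bigr => j _.
    by rewrite fmorphV rmorphB rmorph1 /= fmorph_div.
  rewrite (rmorphM _ (coef k)) /a /=; move: (real_complex R (rho _ _ _ _)) (real_complex R (coef k)) => x y; move: (1 + _)^-1 => t; ring. 
have p0 : \prod_(j < N.+1) (1 + z ^+ 4 / a j) != 0 by apply/prodf_neq0 => i _; exact: h.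
rewrite cmodM ler_wpM2l ?cmod_ge0 // prodfV cmodV lef_pV2 ?posrE ?expR_gt0 ?cmod_gt0 //.
apply: le_trans _ (prod_quartic_le n_gt0 n_sparse N.+1 v0).
elim/big_rec2: _ => [|i x y _ xy]; first by rewrite cmod1.
rewrite cmodM; apply: ler_pM; rewrite ?cmod_ge0 //.
apply: le_trans (cmodD _ _) _; rewrite cmod1 lerD2l cmodM cmodV cmod_real.
by rewrite gtr0_norm.
Qed.

Lemma corner_cauchy0 : cauchy corner_data 0 = 0.
Proof.
apply: csum_def; apply: cvgC_ext (cvgC_cst 0) => m.
rewrite /psum big1 // => k _; rewrite /cterm !big_cons big_nil /= !sub0r !opprK !invrN; ring.
Qed.

Lemma corner_is_zero : is_zero (cauchy corner_data) = [set 0].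
Proof.
have [S hS] := corner_sqrt_mass.
have far := pole_far corner_Im.
apply/seteqP; split => [a za|_ ->].
  have [pa|np] := pselect (is_pole corner_data a).
    have := pole_order hS far corner_uniq (pole_disj corner_Im) corner_neq0 pa.
    by move=> hm; have := (is_zero_order hm).1 za.
  apply/eqP/negPn/negP => a0; have g0 := corner_cauchy_neq0 np a0.
  have [[_ e]|[m [hm hm0]]] := regular_order hS far np.
    by rewrite e eqxx in g0.
  by have := (is_zero_order hm).1 za; rewrite (hm0.2 g0).
have np : ~ is_pole corner_data 0.
  move=> [k [q [qw e]]]; have := side_le_pole corner_Im qw.
  by rewrite e cmod0 leNgt (side_gt0 R n_gt0 n_sparse).
(* [is_zero] includes local vanishing, so the first alternative also makes 0 a zero; in the second
   the value 0 excludes order 0. *)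
have [[lz _]|[m [hm hm0]]] := regular_order hS far np; first by left.
apply/(is_zero_order hm); rewrite ltz_nat lt0n; apply/eqP => /hm0.
by rewrite corner_cauchy0 eqxx.
Qed.

End Construction.

(** * Growth *)

Section Characteristics.
Set Implicit Arguments. Unset Strict Implicit.
Variable R : realType.
Local Notation C := (R[i]).
Variable n : nat -> nat.
Hypothesis n_gt0 : (0 < n 0)%N.
Hypothesis n_sparse : forall k, (2 ^ k.+1 * n k ^ 2 <= n k.+1)%N.
Local Notation side := (side R n).
Local Notation strings := (string_data R n).
Local Notation corners := (corner_data R n).

Lemma between_sides (t : R) : side 0 <= t -> exists k, side k <= t < side k.+1.
Proof.
move=> t0; have ex : exists k, t < side k.
  exists (Num.truncn t).+1; apply: lt_le_trans (truncnS_gt t) _.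
  exact: side_ge n_gt0 n_sparse _.
case: (ex_minnP ex) => -[|k] tk min; first by move: t0; rewrite leNgt tk.
exists k; rewrite tk andbT leNgt; apply/negP => /min.
by rewrite ltnn.
Qed.

Section Blocks.
Variables (w : nat -> seq (C * C)) (S : R).
Hypothesis wS : sqrt_mass_le w S.
Hypothesis w_Im : forall k q, q \in w k -> `|complex.Im q.2| = side k.
Hypothesis w_uniq : forall k, uniq [seq q.2 | q <- w k].
Hypothesis w_neq0 : forall k q, q \in w k -> q.1 != 0.

Lemma npoles_below (t : R) : t < side 0 -> npoles (cauchy w) t = 0.
Proof.
move=> t0; apply: (npoles_cauchy0 wS (pole_far n_gt0 n_sparse w_Im)) => a [k [q [qw <-]]].
apply: lt_le_trans t0 _; apply: le_trans (side_le_pole w_Im qw).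
by case: k {qw} => // k; rewrite ler_nat ltnW // (n_lt n_gt0 n_sparse).
Qed.

Lemma npoles_block (t : R) K : t < side K.+1 ->
  npoles (cauchy w) t <= (\sum_(k < K.+1) size (w k))%:R.
Proof.
move=> tK; apply: (npoles_cauchy_le wS (pole_far n_gt0 n_sparse w_Im) w_uniq
  (pole_disj n_gt0 n_sparse w_Im) w_neq0) => k q qw qt.
rewrite ltnNge; apply/negP => Kk; have := side_le_pole w_Im qw.
have : side K.+1 <= side k.
  by rewrite ler_nat; move: Kk; rewrite leq_eqVlt => /orP[/eqP->//|/(n_lt n_gt0 n_sparse)/ltnW].
by move: tK qt; lra.
Qed.

Lemma nevT_le_log (M r : R) : 1 < r -> (forall t, t <= r -> npoles (cauchy w) t <= M) ->
  (nevT (cauchy w) r <= (64 * S + M * ln r)%:E)%E.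
Proof.
move=> r1 h; rewrite EFinD; apply: leeD; first exact: proximity_cauchy (ltW r1).
apply: counting_le_log => // t t1; apply: npoles_below; apply: lt_le_trans t1 _.
exact: side_ge1 n_gt0 n_sparse 0.
Qed.

End Blocks.

(** Block k has 4 n_k poles, and since n at least doubles at each step the sum up to K is at most
    twice its last term. *)
Lemma npoles_strings_le (t : R) K : t < side K.+1 -> npoles (cauchy strings) t <= 8 * side K.
Proof.
have [S hS] := string_sqrt_mass R n_gt0 n_sparse.
move=> /(npoles_block hS (string_Im n_gt0 n_sparse) (string_uniq R n_gt0 n_sparse)
  (string_neq0 n_gt0 n_sparse)) /le_trans; apply.
rewrite -natrM ler_nat; elim: K => [|K ih].
  rewrite big_ord1 size_cat !size_map size_iota /=; lia.
rewrite big_ord_recr /= size_cat !size_map size_iota.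
by have [_] := n_double n_gt0 n_sparse K; move: ih; move: (\sum_(_ < _) _)%N => s; lia.
Qed.

Lemma npoles_strings_linear (t : R) : 0 < t -> npoles (cauchy strings) t <= 8 * t.
Proof.
move=> t0; have [S hS] := string_sqrt_mass R n_gt0 n_sparse.
have [ts|ts] := ltP t (side 0).
  by rewrite (npoles_below hS (string_Im n_gt0 n_sparse)) // mulr_ge0 // ltW.
have [k /andP[kt tk]] := between_sides ts.
by apply: le_trans (npoles_strings_le tk) _; rewrite ler_wpM2l.
Qed.

Lemma npoles_corners_le (t : R) K : t < side K.+1 ->
  npoles (cauchy corners) t <= 4 * K.+1%:R.
Proof.
have [S hS] := corner_sqrt_mass R n_gt0 n_sparse.
move=> /(npoles_block hS (corner_Im n_gt0 n_sparse) (corner_uniq R n_gt0 n_sparse)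
  (corner_neq0 n_gt0 n_sparse)) /le_trans; apply.
by rewrite (eq_bigr (fun=> 4%N)) // sum_nat_const card_ord mulnC natrM.
Qed.

Lemma strings_nonempty k : strings k != [::].
Proof.
have [k0 _] := n_double n_gt0 n_sparse k.
by rewrite -size_eq0 size_cat !size_map size_iota; lia.
Qed.

Lemma strings_transcendental : transcendental_meromorphic (cauchy strings).
Proof.
have [S hS] := string_sqrt_mass R n_gt0 n_sparse.
have far := pole_far n_gt0 n_sparse (@string_Im R n n_gt0 n_sparse).
have disj := pole_disj n_gt0 n_sparse (@string_Im R n n_gt0 n_sparse).
have neq0 := @string_neq0 R n n_gt0 n_sparse.
split; first exact: cauchy_meromorphic hS far (string_uniq R n_gt0 n_sparse) disj neq0.
exact: (cauchy_not_rational hS far (string_uniq R n_gt0 n_sparse) disj neq0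
  strings_nonempty).
Qed.

Lemma nevT_strings_linear : exists K : R, exists r0 : R, forall r, r0 <= r ->
  (nevT (cauchy strings) r <= (K * r)%:E)%E.
Proof.
have [S hS] := string_sqrt_mass R n_gt0 n_sparse.
have S0 : 0 <= S by apply: le_trans _ (hS 0%N); rewrite big_ord0.
exists (64 * S + 8), 1 => r r1; have r0 : 0 < r := lt_le_trans ltr01 r1.
apply: (@le_trans _ _ ((64 * S)%:E + (8 * r)%:E)%E).
  apply: leeD; first exact: proximity_cauchy.
  apply: counting_le_linear => //; last exact: npoles_strings_linear.
  apply: (npoles_below hS (string_Im n_gt0 n_sparse)); exact: side_gt0.
by rewrite -EFinD lee_fin [leRHS]mulrDl lerD2r ler_peMr // mulr_ge0.
Qed.

(** * Comparison with [phi] *)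

Variable phi : R -> R.
Hypothesis phi_gt0 : forall r, 1 <= r -> 0 < phi r.
Hypothesis phi_le : forall r s, 1 <= r -> r <= s -> phi r <= phi s.

(** For r >= e both ln r >= 1 and phi r >= phi 1 > 0 hold, so a constant is at most a multiple of
    phi r ln r. *)
Lemma absorb_constant (S r : R) : 0 <= S -> expR 1 <= r ->
  64 * S + phi r * ln r <= (64 * S / phi 1 + 1) * (phi r * ln r).
Proof.
move=> S0 re; have e1 : 1 <= expR 1 :> R by rewrite -[leLHS]expR0 ler_expR.
have r1 : 1 <= r by apply: le_trans re.
have l1 : 1 <= ln r.
  by rewrite -[leLHS](expRK 1) ler_ln // posrE ?expR_gt0 // (lt_le_trans ltr01).
have p1 := phi_gt0 (lexx 1); have pr := phi_le (lexx 1) r1.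
rewrite [leRHS]mulrDl mul1r lerD2r -mulrA ler_peMr ?mulr_ge0 //.
rewrite mulrC ler_pdivlMr // mul1r; apply: le_trans pr _.
by rewrite ler_peMr // (le_trans (ltW p1)) // phi_le.
Qed.

(** For n_k <= t < n_(k+1) and t <= r the pole count is at most 4 (k + 1) <= phi(n_k) <= phi r. *)
Lemma nevT_corners_le : (forall k, 4 * k.+1%:R <= phi (side k)) ->
  exists K : R, exists r0 : R, forall r, r0 <= r ->
  (nevT (cauchy corners) r <= (K * (phi r * ln r))%:E)%E.
Proof.
move=> hphi; have [S hS] := corner_sqrt_mass R n_gt0 n_sparse.
have S0 : 0 <= S by apply: le_trans _ (hS 0%N); rewrite big_ord0.
exists (64 * S / phi 1 + 1), (expR 1) => r re.
have r1 : 1 < r by apply: lt_le_trans re; rewrite -[ltLHS]expR0 ltr_expR.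
apply: (@le_trans _ _ (64 * S + phi r * ln r)%:E); last by rewrite lee_fin absorb_constant.
apply: (nevT_le_log hS (corner_Im n_gt0 n_sparse)) => // t tr.
have [ts|ts] := ltP t (side 0).
  by rewrite (npoles_below hS (corner_Im n_gt0 n_sparse)) // ltW // phi_gt0 // ltW.
have [k /andP[kt tk]] := between_sides ts.
apply: le_trans (npoles_corners_le tk) _; apply: le_trans (hphi k) _.
by apply: phi_le (le_trans kt tr); exact: side_ge1.
Qed.

(** At the radius r given by the gap condition, the count up to r is still at most 8 n_k, which phi
    r already exceeds or equals. *)
Lemma nevT_strings_liminf :
  (forall k, exists r, side k <= r < side k.+1 /\ 8 * side k <= phi r) ->
  exists K : R, forall r0, exists r, r0 <= r /\
  (nevT (cauchy strings) r <= (K * (phi r * ln r))%:E)%E.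
Proof.
move=> hgap; have [S hS] := string_sqrt_mass R n_gt0 n_sparse.
have S0 : 0 <= S by apply: le_trans _ (hS 0%N); rewrite big_ord0.
exists (64 * S / phi 1 + 1) => r0.
(* Since n_k >= k, this index places the gap beyond both r0 and e. *)
have [r [/andP[kr rk] hr]] := hgap (Num.truncn (Num.max r0 (expR 1))).+1.
have : Num.max r0 (expR 1) <= r.
  apply: le_trans kr; apply: le_trans (side_ge R n_gt0 n_sparse _).
  exact/ltW/truncnS_gt.
rewrite ge_max => /andP[r0r re]; exists r; split => //.
have r1 : 1 < r by apply: lt_le_trans re; rewrite -[ltLHS]expR0 ltr_expR.
apply: (@le_trans _ _ (64 * S + phi r * ln r)%:E); last by rewrite lee_fin absorb_constant.
apply: (nevT_le_log hS (string_Im n_gt0 n_sparse)) => // t tr.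
by apply: le_trans hr; apply: npoles_strings_le; exact: le_lt_trans tr rk.
Qed.

End Characteristics.

(** * Choice of the sparse sequence, and the theorem *)

Lemma sparse_sequence (R : realType) (phi : R -> R) :
  phi r @[r --> +oo] --> +oo ->
  exists n : nat -> nat, [/\ (0 < n 0)%N,
    forall k, (2 ^ k.+1 * n k ^ 2 <= n k.+1)%N,
    forall k, 4 * k.+1%:R <= phi (side R n k) &
    forall k, exists r, side R n k <= r < side R n k.+1 /\ 8 * side R n k <= phi r].
Proof.
move=> /cvgryPge phioo.
have big (M : R) (m0 : nat) : exists m : nat, (m0 <= m)%N /\ M <= phi m%:R.
  have [x [_ hx]] := phioo M; pose m := maxn m0 (Num.truncn x).+1.
  exists m; split; first exact: leq_maxl.
  apply: hx; apply: lt_le_trans (truncnS_gt x) _.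
  by rewrite ler_nat leq_maxr.
(* The pair holds k and n_k, since the conditions on the next term depend on both. *)
have step (km : nat * nat) : exists m', [/\ (2 ^ km.1.+1 * km.2 ^ 2 <= m')%N,
    4 * km.1.+2%:R <= phi m'%:R &
    exists r : R, km.2%:R <= r < m'%:R /\ 8 * km.2%:R <= phi r].
  have [j [mj hj]] := big (8 * km.2%:R) km.2.
  (* Starting from j + 1 puts the radius j, where phi has reached 8 n_k, strictly before the next
     term. *)
  have [m' [mm' hm']] := big (4 * km.1.+2%:R) (maxn j.+1 (2 ^ km.1.+1 * km.2 ^ 2)).
  move: mm'; rewrite geq_max => /andP[jm' km']; exists m'; split => //.
  by exists j%:R; rewrite ler_nat mj ltr_nat.
have [next hnext] := choice step.
have [m0 [m01 hm0]] := big 4 1%N.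
pose n := fix n k := if k is k'.+1 then next (k', n k') else m0.
exists n; split=> // [k|[|k]|k].
- by have [] := hnext (k, n k).
- by rewrite mulr1.
- by have [] := hnext (k, n k).
- by have [] := hnext (k, n k).
Qed.

Theorem theorem1p5 (R : realType) (phi : R -> R) :
  (forall r : R, 1 <= r -> 0 < phi r) ->
  (forall r s : R, 1 <= r -> r <= s -> phi r <= phi s) ->
  phi r @[r --> +oo] --> +oo ->
  exists f : R[i] -> R[i],
    transcendental_meromorphic f /\
    (* limsup_{r->oo} T(r,f)/r < oo *)
    (exists K : R, exists r0 : R, forall r : R, r0 <= r ->
       (nevT f r <= (K * r)%:E)%E) /\
    (* liminf_{r->oo} T(r,f)/(phi(r) log r) < oo *)
    (exists K : R, forall r0 : R, exists r : R, r0 <= r /\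
       (nevT f r <= (K * (phi r * ln r))%:E)%E) /\
    (let g := fun z : R[i] => f (z + 1) - f z in
     (* g has exactly one zero *)
     (exists a : R[i], is_zero g = [set a]) /\
     (* limsup_{r->oo} T(r,g)/(phi(r) log r) < oo *)
     (exists K : R, exists r0 : R, forall r : R, r0 <= r ->
       (nevT g r <= (K * (phi r * ln r))%:E)%E)).
Proof.
move=> phi_gt0 phi_le /sparse_sequence[n [n_gt0 n_sparse n_phi n_gap]].
exists (cauchy (string_data R n)).
(* An equality of functions, poles included, so every claim about g becomes one about the corner
   sum. *)
have -> : (fun z => cauchy (string_data R n) (z + 1) - cauchy (string_data R n) z)
  = cauchy (corner_data R n).
  by apply/funext => z; exact: string_cauchy_difference.
split; first exact: strings_transcendental.
split; first exact: nevT_strings_linear.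
split; first exact: nevT_strings_liminf.
split; last exact: nevT_corners_le.
by exists 0; exact: corner_is_zero.
Qed.
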